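(* For each $n=1,2,\ldots$ let $p_n\ge1$, let $\mathbf{X}_n\in\mathbb{R}^{n\times p_n}$ be a fixed design, $\beta^0_n\in\mathbb{R}^{p_n}$, and $\mathbf{Y}_n=\mathbf{X}_n\beta^0_n+\varepsilon_n$ with $\varepsilon_{n,1},\ldots,\varepsilon_{n,n}$ i.i.d. $\mathcal{N}(0,\sigma^2)$, $\sigma>0$. Let $\lambda_n>0$ with $\Omega_{\min}(\lambda_n)>0$ for all $n$ (not necessarily bounded away from $0$) and $$n^{1/2}\,\|\theta^0_n\|_2\,\lambda_n\,\Omega_{\min}(\lambda_n)^{-1/2}\,\lambda_{\min\neq0}(\hat\Sigma_n)^{-1}\to0\quad(n\to\infty),$$ i.e. $\lambda_n\Omega_{\min}(\lambda_n)^{-1/2}=o(n^{-1/2}\|\theta^0_n\|_2^{-1}\lambda_{\min\neq0}(\hat\Sigma_n))$. Let $\hat\beta_{\mathrm{init}}$ be an estimator of $\beta^0_n$ and let $\Delta_{j,n}>0$ ($1\le j\le p_n$) be constants satisfying assumption (A): $$\mathbb{P}\Big[\bigcap_{j=1}^{p_n}\Big\{\Big|a_{n,p;j}(\sigma)\sum_{k\neq j}(P_{\mathbf{X}})_{jk}(\hat\beta_{\mathrm{init};k}-\beta^0_k)\Big|\le\Delta_{j,n}\Big\}\Big]\to1\quad(n\to\infty).$$ Then: (i) for any sequence of indices $j=j_n\in\{1,\ldots,p_n\}$ with $\beta^0_{n,j_n}=0$ for all $n$, and every $u>0$, $$\limsup_{n\to\infty}\Big(\mathbb{P}\big[a_{n,p;j}(\sigma)|\hat\beta_{\mathrm{corr};j}|>u\big]-\mathbb{P}\big[|W|+\Delta_{j,n}>u\big]\Big)\le0,$$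 where $W\sim\mathcal{N}(0,1)$; (ii) for any sequence of subsets $G_n\subseteq\{1,\ldots,p_n\}$ with $\beta^0_{n,j}=0$ for all $j\in G_n$ and all $n$, and every $u>0$, $$\limsup_{n\to\infty}\Big(\mathbb{P}\big[\max_{j\in G_n}a_{n,p;j}(\sigma)|\hat\beta_{\mathrm{corr};j}|>u\big]-\mathbb{P}\big[\max_{j\in G_n}(a_{n,p;j}(\sigma)|Z_j|+\Delta_{j,n})>u\big]\Big)\le0,$$ where $(Z_1,\ldots,Z_{p_n})\sim\mathcal{N}_{p_n}(0,n^{-1}\sigma^2\Omega(\lambda_n))$.
   Context: All quantities depend on $n$ (index suppressed where convenient). $\hat\Sigma_n=n^{-1}\mathbf{X}_n^T\mathbf{X}_n$; $P_{\mathbf{X}}=\mathbf{X}_n^T(\mathbf{X}_n\mathbf{X}_n^T)^{-}\mathbf{X}_n$ (Moore–Penrose pseudo-inverse), the orthogonal projection onto the row space of $\mathbf{X}_n$; $\theta^0_n=P_{\mathbf{X}}\beta^0_n$. $\Omega(\lambda)=(\hat\Sigma_n+\lambda I)^{-1}\hat\Sigma_n(\hat\Sigma_n+\lambda I)^{-1}$, $\Omega_{\min}(\lambda)=\min_j\Omega_{jj}(\lambda)$; $\lambda_{\min\neq0}(A)$ is the smallest nonzero eigenvalue of a symmetric $A$. Ridge estimator $\hat\beta=(\hat\Sigma_n+\lambda_nI)^{-1}n^{-1}\mathbf{X}_n^T\mathbf{Y}_n$; corrected Ridge estimator $\hat\beta_{\mathrm{corr};j}=\hat\beta_j-\sum_{k\neq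 j}(P_{\mathbf{X}})_{jk}\hat\beta_{\mathrm{init};k}$. Normalizing factors $a_{n,p;j}(\sigma)=n^{1/2}\sigma^{-1}\Omega_{jj}(\lambda_n)^{-1/2}$. *)

(* Defs.v *)
From HB Require Import structures.
From mathcomp Require Import all_boot all_order all_algebra.
From mathcomp Require Import all_classical all_reals all_analysis.
Set Implicit Arguments. Unset Strict Implicit. Unset Printing Implicit Defensive.
Import Order.TTheory GRing.Theory Num.Theory.
Import numFieldNormedType.Exports.
Local Open Scope classical_set_scope.
Local Open Scope ring_scope.

Section Defs.
Context {R : realType}.

Definition Sigma_hat (N p : nat) (X : 'M[R]_(N, p)) : 'M[R]_p :=
  (N%:R)^-1 *: (X^T *m X).

Definition Omega_mx (p : nat) (S : 'M[R]_p) (lam : R) : 'M[R]_p :=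
  invmx (S + lam%:M) *m S *m invmx (S + lam%:M).

(* Omega_min = min_j Omega_jj (p >= 1 in all uses) *)
Definition Omega_min (p : nat) (O : 'M[R]_p) : R :=
  inf [set O j j | j in [set: 'I_p]].

Definition lambda_min_nz (p : nat) (S : 'M[R]_p) : R :=
  inf [set a : R | eigenvalue S a /\ a != 0].

Definition is_MP_pinv (m : nat) (A B : 'M[R]_m) : Prop :=
  [/\ A *m B *m A = A, B *m A *m B = B,
      (A *m B)^T = A *m B & (B *m A)^T = B *m A].

(* P_X = X^T (X X^T)^- X, given Ginv = (X X^T)^- *)
Definition PX (N p : nat) (X : 'M[R]_(N, p)) (Ginv : 'M[R]_N) : 'M[R]_p :=
  X^T *m Ginv *m X.

Definition norm2 (p : nat) (v : 'cV[R]_p) : R :=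
  Num.sqrt (\sum_(i < p) v i 0 ^+ 2).

Definition a_coef (N p : nat) (sigma : R) (O : 'M[R]_p) (j : 'I_p) : R :=
  Num.sqrt (N%:R) * sigma^-1 * (Num.sqrt (O j j))^-1.

Definition ridge (N p : nat) (X : 'M[R]_(N, p)) (lam : R) (Y : 'cV[R]_N)
  : 'cV[R]_p :=
  invmx (Sigma_hat X + lam%:M) *m ((N%:R)^-1 *: (X^T *m Y)).

Definition ridge_corr (p : nat) (P : 'M[R]_p) (bhat binit : 'cV[R]_p)
  (j : 'I_p) : R :=
  bhat j 0 - \sum_(k < p | k != j) P j k * binit k 0.

Definition gauss0 (v : R) : set R -> \bar R :=
  if v == 0 then (\d_(0:R) : set R -> \bar R)
  else normal_prob 0 (Num.sqrt v).

Definition mutually_independent d (T : measurableType d)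
  (P : probability T R) (n : nat) (X : 'I_n -> T -> R) : Prop :=
  forall B : 'I_n -> set R, (forall i, measurable (B i)) ->
    P (\bigcap_(i in [set: 'I_n]) (X i @^-1` B i)) =
    (\prod_(i < n) P (X i @^-1` B i))%E.

Definition gaussian_vector d (T : measurableType d) (P : probability T R)
  (p : nat) (Z : 'I_p -> T -> R) (C : 'M[R]_p) : Prop :=
  (forall i, measurable_fun setT (Z i)) /\
  forall (c : 'I_p -> R) (B : set R), measurable B ->
    P ((fun w => \sum_(i < p) c i * Z i w) @^-1` B) =
    gauss0 (\sum_(i < p) \sum_(k < p) c i * C i k * c k) B.

End Defs.

(* Main.v *)
Require Import Defs.
From HB Require Import structures.
From mathcomp Require Import all_boot all_order all_algebra.
From mathcomp Require Import all_classical all_reals all_analysis.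
From mathcomp Require Import spectral complex measurable_realfun ring lra.
Set Implicit Arguments. Unset Strict Implicit. Unset Printing Implicit Defensive.
Import Order.TTheory GRing.Theory Num.Theory.
Import numFieldNormedType.Exports.
Local Open Scope classical_set_scope.
Local Open Scope ring_scope.

(**
For [j] with [beta0_j = 0] the corrected ridge estimator is [Z_j] minus the
ridge bias minus the estimation error of the correction term, where [Z] is the
linear image [B eps] of the noise and [Omega = n B B^T].  As [P_X beta0] lies in
the range of [Sigma_hat], the bias is at most [lam |theta| / lambda_min], so the
rate hypothesis makes [a_j * bias_j] negligible uniformly in [j], and
hypothesis (A) controls the remaining term by [Delta_j].

It remains to pass from the level [u - del] to the level [u] for
[max_j (a_j |Z_j| + Delta_j)], uniformly in the number of coordinates.  On the
part of space where a given index [k] realises the maximum, shifting the noise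
along the covariance direction of [Z_k] raises the [k]-th coordinate at least
as much as any other one; so [k] still realises the maximum, which has
increased by exactly the length of the shift.  By Cameron-Martin such a shift
changes the measure by a factor bounded in terms of [u] only.  Hence the slabs
[(u - del + i del, u + i del]], [i < 1/del], all carry at least a fixed fraction
of the mass of the first one, which is therefore [O(del)].

In part (ii) the vector [Z] lives on another space and is only known through its
projections.  Equality of the laws of all projections gives equality of the
means of trigonometric polynomials, and indicators of boxes are bounded
pointwise limits of those.
*)

(** * Integration against normal laws *)

Section Lebesgue_affine.
Context {R : realType}.
Implicit Types (a b : R) (f : R -> \bar R).

Lemma measurable_affine a b : measurable_fun [set: measurableTypeR R]
  (fun x : measurableTypeR R => (a * x + b : measurableTypeR R)).
Proof. by apply: measurable_funD => //; exact: measurable_funM. Qed.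

(** Lebesgue measure is determined by its values on the intervals []x, y]], whose preimages are [](x
    - b) / a, (y - b) / a]]; the left side is thus a scaled pushforward with the same values. *)
Lemma lebesgue_measure_affine a b (A : set R) : 0 < a -> measurable A ->
  (a%:E * (@lebesgue_measure R) ((fun x => (a * x + b)%R) @^-1` A) =
   lebesgue_measure A)%E.
Proof.
move=> a0 mA.
pose k := NngNum (ltW a0).

pose H := isMeasurableFun.Build _ _ _ _ _ (measurable_affine a b).
pose F : {mfun measurableTypeR R >-> measurableTypeR R} := HB.pack (fun x : measurableTypeR R => (a * x + b : measurableTypeR R)) H.
rewrite [in RHS](@lebesgue_measure_unique R (mscale k (pushforward (@lebesgue_measure R) F)))//.
move=> _ [[x y] _ <-] /=.
rewrite /mscale/= /pushforward.
have -> : (fun x => a * x + b) @^-1` `]x, y]%classic = `](x - b) / a, (y - b) / a]%classic.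
  apply/seteqP; split => z /=; rewrite !in_itv/= ltr_pdivrMr// ler_pdivlMr// => /andP[h1 h2];
    apply/andP; split; lra.
rewrite !lebesgue_measure_itv/= !lte_fin ltr_pM2r ?invr_gt0// ltrD2r.
case: ifPn => _; last by rewrite mule0.
by rewrite -!EFinD -EFinM; congr EFin; field; rewrite gt_eqF.
Qed.

Lemma ge0_integral_affine a b f : 0 < a -> measurable_fun setT f ->
  (forall x, 0 <= f x)%E ->
  (\int[lebesgue_measure]_x f x =
   a%:E * \int[lebesgue_measure]_x f (a * x + b)%R)%E.
Proof.
move=> a0 mf f0.
pose F : {mfun measurableTypeR R >-> measurableTypeR R} := HB.pack
  (fun x : measurableTypeR R => (a * x + b : measurableTypeR R))
  (isMeasurableFun.Build _ _ _ _ _ (measurable_affine a b)).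
have := @ge0_integral_pushforward _ _ _ _ R _ (measurable_affine a b) lebesgue_measure setT f
  measurableT mf (fun x _ => f0 x).
rewrite preimage_setT => E.
transitivity (a%:E * \int[pushforward lebesgue_measure F]_x f x)%E; last first.
  by congr (_ * _)%E; rewrite -E.
rewrite -(@ge0_integral_mscale _ _ _ _ _ measurableT (NngNum (ltW a0)))//.
apply: eq_measure_integral => A mA _.
by rewrite -[LHS](lebesgue_measure_affine b a0).
Qed.

End Lebesgue_affine.

Section normal_prob_integral.
Context {R : realType}.
Local Notation mu := (@lebesgue_measure R).

(** The Radon-Nikodym derivative of the normal law and [normal_pdf] have the same integral over
    every measurable set, hence agree almost everywhere. *)
Lemma ge0_integral_normal_prob (m s : R) (f : R -> \bar R) :
  measurable_fun setT f -> (forall x, 0 <= f x)%E ->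
  (\int[normal_prob m s]_x f x = \int[mu]_x (f x * (normal_pdf m s x)%:E))%E.
Proof.
move=> mf f0.
have dom := @normal_prob_dominates R m s.
rewrite -(Radon_Nikodym_SigmaFinite.change_of_variables dom)//.
apply: ae_eq_integral => //.
- apply: emeasurable_funM => //; apply: (measurable_int mu).
  exact: Radon_Nikodym_SigmaFinite.f_integrable.
- apply: emeasurable_funM => //; apply/measurable_EFinP.
  exact: measurable_normal_pdf.
- apply: ae_eqe_mul2l => /=.
  apply: integral_ae_eq => //=.
  + exact: Radon_Nikodym_SigmaFinite.f_integrable.
  + by apply/measurable_EFinP; exact: measurable_normal_pdf.
  + by move=> E _ mE; rewrite -Radon_Nikodym_SigmaFinite.f_integral.
Qed.

End normal_prob_integral.

Section normal_calculus.
Context {R : realType}.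
Local Notation mu := (@lebesgue_measure R).

Lemma ge0_integral_lebesgueN (f : R -> \bar R) :
  measurable_fun setT f -> (forall x, 0 <= f x)%E ->
  (\int[mu]_x f (- x)%R = \int[mu]_x f x)%E.
Proof.
move=> mf f0.
have mN : measurable_fun [set: measurableTypeR R] (-%R : _ -> measurableTypeR R).
  exact: measurable_funN.
have := @ge0_integral_pushforward _ _ _ _ R _ mN mu setT f measurableT mf (fun x _ => f0 x).
rewrite preimage_setT => E.
transitivity (\int[pushforward mu (-%R : measurableTypeR R -> measurableTypeR R)]_x f x)%E.
  by rewrite -E.
by apply: eq_measure_integral => A mA _; exact: lebesgue_measureN.
Qed.

(** Cameron-Martin in dimension one: the exponential is the ratio of the densities of the laws with
    means [h] and [0], as the substitution of [x + h] for [x] shows. *)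
Lemma ge0_integral_normal_prob_shift (s h : R) (f : R -> \bar R) : s != 0 ->
  measurable_fun setT f -> (forall x, 0 <= f x)%E ->
  (\int[normal_prob 0 s]_x f (x + h)%R =
   \int[normal_prob 0 s]_x (f x * (expR (h * x / s ^+ 2 - h ^+ 2 / (s ^+ 2 *+ 2)))%:E))%E.
Proof.
move=> s0 mf f0.
have mg : measurable_fun setT (fun x => (expR (h * x / s ^+ 2 - h ^+ 2 / (s ^+ 2 *+ 2)))%:E).
  apply/measurable_EFinP; apply: measurableT_comp => //; apply: measurable_funB => //.
  by apply: measurable_funM => //; apply: measurable_funM.
rewrite ge0_integral_normal_prob//; last first.
  by apply: measurableT_comp => //; apply: measurable_funD.
rewrite [RHS]ge0_integral_normal_prob//; last 2 first.
- exact: emeasurable_funM.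
- by move=> x; rewrite mule_ge0// lee_fin expR_ge0.
rewrite [RHS](@ge0_integral_affine _ 1 h)//; last first.
- by move=> x; rewrite !mule_ge0// lee_fin ?expR_ge0// normal_pdf_ge0.
- apply: emeasurable_funM; first exact: emeasurable_funM.
  by apply/measurable_EFinP; exact: measurable_normal_pdf.
rewrite mul1e; apply: eq_integral => x _.
rewrite mul1r -muleA; congr (_ * _)%E.
rewrite -EFinM; congr EFin.
rewrite !normal_pdfE// /normal_fun mulrCA; congr (_ * _).
by rewrite -expRD; congr expR; field.
Qed.

Lemma ge0_integral_normal_prob_scale (s c : R) (f : R -> \bar R) : s != 0 -> c != 0 ->
  measurable_fun setT f -> (forall x, 0 <= f x)%E ->
  (\int[normal_prob 0 s]_x f (c * x)%R =
   \int[normal_prob 0 (c * s)]_x f x)%E.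
Proof.
move=> s0 c0 mf f0.
have mc (a : R) : measurable_fun setT (fun x : R => f (a * x)).
  by apply: measurableT_comp => //; exact: measurable_funM.
(* The affine substitution requires a positive factor. A negative [c] is replaced by [- c]: the
   centred density is even, and [c * s] enters it only through its square. *)
wlog: c c0 / 0 < c.
  move=> H; have := c0; rewrite neq_lt => /orP[cn|cp]; last exact: H.
  transitivity (\int[normal_prob 0 s]_x f (- c * x)%R)%E.
    have mF : measurable_fun setT (fun x : R => (f (- c * x)%R * (normal_pdf 0 s x)%:E)%E).
      apply: emeasurable_funM; first exact: mc.
      by apply/measurable_EFinP; exact: measurable_normal_pdf.
    have F0 x : (0 <= f (- c * x)%R * (normal_pdf 0 s x)%:E)%E.
      by rewrite mule_ge0// lee_fin normal_pdf_ge0.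
    rewrite (ge0_integral_normal_prob 0 s (mc c))//.
    rewrite (ge0_integral_normal_prob 0 s (mc (- c)))//.
    rewrite -(ge0_integral_lebesgueN mF F0).
    apply: eq_integral => x _; rewrite mulrNN; congr (_ * (_)%:E)%E.
    by rewrite !normal_pdfE// /normal_fun !subr0 sqrrN.
  have nc0 : - c != 0 by rewrite oppr_eq0.
  have nc : 0 < - c by rewrite oppr_gt0.
  apply: etrans (H _ nc0 nc) _.
  apply: etrans (ge0_integral_normal_prob 0 (- c * s) mf f0) _.
  apply/esym; apply: etrans (ge0_integral_normal_prob 0 (c * s) mf f0) _; apply/esym.
  apply: eq_integral => x _.
  have cs : c * s != 0 by rewrite mulf_neq0.
  rewrite mulNr (normal_pdfE _ cs) normal_pdfE ?oppr_eq0//.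
  by rewrite /normal_peak /normal_fun sqrrN.
move=> cp; apply/esym.
apply: etrans (ge0_integral_normal_prob 0 (c * s) mf f0) _; apply/esym.
apply: etrans (ge0_integral_normal_prob 0 s (mc c) (fun x => f0 _)) _.
rewrite [RHS](@ge0_integral_affine _ c 0)//; last first.
- by move=> x; rewrite mule_ge0// lee_fin normal_pdf_ge0.
- apply: emeasurable_funM => //.
  by apply/measurable_EFinP; exact: measurable_normal_pdf.
rewrite -ge0_integralZl//; first last.
- by rewrite lee_fin ltW.
- by move=> x _; rewrite mule_ge0// lee_fin normal_pdf_ge0.
- apply: emeasurable_funM => //.
    by apply: measurableT_comp => //; apply: measurable_funD => //; apply: measurable_funM.
  apply/measurable_EFinP; apply: measurableT_comp; first exact: measurable_normal_pdf.
  by apply: measurable_funD => //; apply: measurable_funM.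
apply: eq_integral => x _; rewrite addr0 muleCA; congr (_ * _)%E.
rewrite -EFinM; congr EFin.
rewrite !normal_pdfE ?mulf_neq0// mulrA; congr (_ * _).
  rewrite /normal_peak; have -> : (c * s) ^+ 2 * pi *+ 2 = c ^+ 2 * (s ^+ 2 * pi *+ 2) by ring.
  rewrite [in RHS]sqrtrM ?sqr_ge0// sqrtr_sqr gtr0_norm//.
  by rewrite invfM mulVKf.
by rewrite /normal_fun; congr expR; field; rewrite s0 c0.
Qed.

(** Completing the square in [x]: the joint density of a normal variable and its sum [y] with an
    independent one is the density of [y] times the conditional density of [x] given [y]. *)
Lemma normal_pdf_conv (t s x y : R) : t != 0 -> s != 0 ->
  normal_pdf 0 t x * normal_pdf 0 s (y - x) =
  normal_pdf 0 (Num.sqrt (t ^+ 2 + s ^+ 2)) y *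
  normal_pdf (t ^+ 2 / (t ^+ 2 + s ^+ 2) * y) (t * s / Num.sqrt (t ^+ 2 + s ^+ 2)) x.
Proof.
move=> t0 s0.
have t2 : 0 < t ^+ 2 by rewrite exprn_even_gt0.
have s2 : 0 < s ^+ 2 by rewrite exprn_even_gt0.
have S2 : 0 < t ^+ 2 + s ^+ 2 by rewrite addr_gt0.
have SS : Num.sqrt (t ^+ 2 + s ^+ 2) ^+ 2 = t ^+ 2 + s ^+ 2 by rewrite sqr_sqrtr// ltW.
have S0 : Num.sqrt (t ^+ 2 + s ^+ 2) != 0 by rewrite gt_eqF// sqrtr_gt0.
rewrite !normal_pdfE// ?mulf_neq0 ?invr_eq0// mulrACA [RHS]mulrACA; congr (_ * _).
  have p2 (z : R) : 0 <= z ^+ 2 * pi *+ 2.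
    by rewrite mulrn_wge0// mulr_ge0 ?sqr_ge0 ?pi_ge0.
  rewrite /normal_peak -!invfM -!sqrtrM//.
  congr (Num.sqrt _)^-1; rewrite expr_div_n exprMn SS.
  by field; rewrite gt_eqF.
rewrite /normal_fun -!expRD; congr expR.
rewrite expr_div_n exprMn SS.
by field; rewrite t0 s0 gt_eqF.
Qed.

(** After Tonelli and the factorisation [normal_pdf_conv], the inner integral is that of a
    conditional density and equals one. *)
Lemma normal_prob_conv (t s : R) (f : R -> \bar R) : t != 0 -> s != 0 ->
  measurable_fun setT f -> (forall x, 0 <= f x)%E ->
  (\int[normal_prob 0 t]_x \int[normal_prob 0 s]_y f (x + y)%R =
   \int[normal_prob 0 (Num.sqrt (t ^+ 2 + s ^+ 2))]_y f y)%E.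
Proof.
move=> t0 s0 mf f0.
have mpdf (m v : R) (g : R -> R) : measurable_fun setT g -> measurable_fun setT (fun x => normal_pdf m v (g x)).
  by move=> mg; apply: measurableT_comp => //; exact: measurable_normal_pdf.
transitivity (\int[normal_prob 0 t]_x \int[mu]_y (f y * (normal_pdf 0 s (y - x))%:E))%E.
  apply: eq_integral => x _.
  have mfx : measurable_fun setT (fun y => f (x + y)).
    by apply: measurableT_comp => //; exact: measurable_funD.
  apply: etrans (ge0_integral_normal_prob 0 s mfx (fun y => f0 _)) _.
  rewrite [RHS](@ge0_integral_affine _ 1 x)//; last first.
  - by move=> y; rewrite mule_ge0// lee_fin normal_pdf_ge0.
  - apply: emeasurable_funM => //; apply/measurable_EFinP; apply: mpdf.
    exact: measurable_funB.
  rewrite mul1e; apply: eq_integral => y _; rewrite mul1r addrK; congr (f _ * _)%E.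
  by rewrite addrC.
pose g (z : R * R) := (f z.2 * (normal_pdf 0 t z.1 * normal_pdf 0 s (z.2 - z.1))%:E)%E.
have mg : measurable_fun setT g.
  apply: emeasurable_funM; first exact: measurableT_comp.
  apply/measurable_EFinP; apply: measurable_funM.
    by apply: measurableT_comp => //; exact: measurable_normal_pdf.
  apply: measurableT_comp; first exact: measurable_normal_pdf.
  exact: measurable_funB.
have g0 z : (0 <= g z)%E by rewrite mule_ge0// lee_fin mulr_ge0// normal_pdf_ge0.
have gE x : (\int[mu]_y g (x, y) =
    (\int[mu]_y (f y * (normal_pdf 0 s (y - x))%:E)) * (normal_pdf 0 t x)%:E)%E.
  rewrite -ge0_integralZr//; last by rewrite lee_fin normal_pdf_ge0.
  - by apply: eq_integral => y _; rewrite /g/= -muleA -EFinM [in RHS]mulrC.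
  - apply: emeasurable_funM => //; apply/measurable_EFinP; apply: mpdf.
    exact: measurable_funB.
  - by move=> y _; rewrite mule_ge0// lee_fin normal_pdf_ge0.
have mG : measurable_fun setT (fun x : R => \int[mu]_y (f y * (normal_pdf 0 s (y - x)%R)%:E))%E.
  pose k (z : R * R) := (f z.2 * (normal_pdf 0 s (z.2 - z.1))%:E)%E.
  have mk : measurable_fun setT k.
    apply: emeasurable_funM; first exact: measurableT_comp.
    apply/measurable_EFinP; apply: measurableT_comp; first exact: measurable_normal_pdf.
    exact: measurable_funB.
  have k0 z : (0 <= k z)%E by rewrite mule_ge0// lee_fin normal_pdf_ge0.
  exact: (measurable_fun_fubini_tonelli_F (m2 := mu) k mk k0).
apply: etrans (ge0_integral_normal_prob 0 t mG _) _.
  by move=> x; apply: integral_ge0 => y _; rewrite mule_ge0// lee_fin normal_pdf_ge0.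
under eq_integral do rewrite -gE.
apply: etrans (@fubini_tonelli _ _ _ _ _ mu mu g mg g0) _.
apply/esym; apply: etrans (ge0_integral_normal_prob _ _ mf f0) _; apply/esym.
apply: eq_integral => y _.
rewrite /g/= ; under eq_integral do rewrite normal_pdf_conv// EFinM muleA.
rewrite ge0_integralZl//; last 3 first.
- by apply/measurable_EFinP; exact: measurable_normal_pdf.
- by move=> x _; rewrite lee_fin normal_pdf_ge0.
- by rewrite mule_ge0// lee_fin normal_pdf_ge0.
by rewrite integral_normal_pdf mule1.
Qed.

End normal_calculus.

(** * Independence and the Cameron-Martin formula *)

Section tuple_measure.
Context {R : realType} (n : nat).

Definition box (B : 'I_n -> set R) : set (n.-tuple R) :=
  [set t | forall i, B i (tnth t i)].

Lemma measurable_box (B : 'I_n -> set R) :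
  (forall i, measurable (B i)) -> measurable (box B).
Proof.
move=> mB.
rewrite (_ : box B = \bigcap_(i in [set: 'I_n]) ((fun t => tnth t i) @^-1` B i)).
  apply: fin_bigcap_measurable => // i _.
  by rewrite -[X in measurable X]setTI; exact: measurable_tnth.
by apply/seteqP; split => [t bt i _|t bt i]; exact: bt.
Qed.

(** Boxes are stable under intersection and generate the product sigma-algebra; as the whole space
    is a box of finite mass, uniqueness of measures applies. *)
Lemma eq_measure_tuple (m1 m2 : {measure set (n.-tuple R) -> \bar R}) :
  (m1 setT < +oo)%E ->
  (forall B, (forall i, measurable (B i)) -> m1 (box B) = m2 (box B)) ->
  forall A, measurable A -> m1 A = m2 A.
Proof.
move=> m1oo m12 A mA.
pose G := [set box B | B in [set B : 'I_n -> set R | forall i, measurable (B i)]].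
have mG : G `<=` measurable by move=> _ [B mB <-]; exact: measurable_box.
apply: (@measure_unique _ R (n.-tuple R : measurableType _) G (fun=> setT)) => //.
- apply/seteqP; split; last first.
    by apply: smallest_sub => //; exact: sigma_algebra_measurable.
  apply: smallest_sub; first exact: smallest_sigma_algebra.
  rewrite -bigcup_seq => X [i _] [B mB <-].
  (* A cylinder over coordinate [i] is a box whose other sides are the whole line. *)
  apply: sub_sigma_algebra; exists (fun j => if j == i then B else setT).
    by move=> j /=; case: ifP.
  apply/seteqP; split => t /=.
    by move=> /(_ i); rewrite eqxx; split.
  by move=> [_ Bt] j; case: eqP => // ->.
- move=> _ _ [B mB <-] [C mC <-]; exists (fun i => B i `&` C i).
    by move=> i; exact: measurableI.
  apply/seteqP; split => t /=; first by move=> H; split => i; case: (H i).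
  by move=> [h1 h2] i; split; [exact: h1|exact: h2].
- move=> _; exists (fun=> setT) => //.
  by apply/seteqP; split.
- by apply/seteqP; split => // t _; exists 0%N.
- by move=> _ [B mB <-]; exact: m12.
Qed.

End tuple_measure.

Section independence.
Context {R : realType} d (T : measurableType d) (P : probability T R).

Definition jointly n (e : 'I_n -> T -> R) (w : T) : n.-tuple R :=
  [tuple e i w | i < n].

Lemma measurable_jointly n (e : 'I_n -> T -> R) :
  (forall i, measurable_fun setT (e i)) -> measurable_fun setT (jointly e).
Proof.
move=> me; apply/measurable_fun_tnthP => i.
by rewrite (_ : _ \o _ = e i)//; apply/funext => w /=; rewrite tnth_mktuple.
Qed.

Definition tail n (e : 'I_n.+1 -> T -> R) (i : 'I_n) := e (lift ord0 i).

Lemma jointly_box n (e : 'I_n -> T -> R) B :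
  jointly e @^-1` box B = \bigcap_(i in [set: 'I_n]) (e i @^-1` B i).
Proof.
apply/seteqP; split => w /=.
  by move=> H i _; have := H i; rewrite tnth_mktuple.
by move=> H i; rewrite tnth_mktuple; exact: H.
Qed.

Lemma mutually_independent_cons n (e : 'I_n.+1 -> T -> R) :
  mutually_independent P e ->
  forall (A : set R) (B : 'I_n -> set R), measurable A -> (forall i, measurable (B i)) ->
  P ((e ord0 @^-1` A) `&` (jointly (tail e) @^-1` box B)) =
  (P (e ord0 @^-1` A) * \prod_(i < n) P (tail e i @^-1` B i))%E.
Proof.
move=> ie A B mA mB.
pose C i := if unlift ord0 i is Some j then B j else A.
have C0 : C ord0 = A by rewrite /C unlift_none.
have CS j : C (lift ord0 j) = B j by rewrite /C liftK.
have := ie C; rewrite big_ord_recl C0.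
under eq_bigr do rewrite CS.
move=> <-; last by move=> i; rewrite /C; case: unliftP.
congr (P _); rewrite jointly_box; apply/seteqP; split => w /=.
  move=> [w0 wB] i _; case: (unliftP ord0 i) => [j ->|->]; rewrite /= ?CS ?C0//.
  exact: wB.
move=> H; split; first by rewrite -C0; exact: H.
by move=> i _; rewrite -CS; exact: H.
Qed.

Lemma mutually_independent_tail n (e : 'I_n.+1 -> T -> R) :
  mutually_independent P e -> mutually_independent P (tail e).
Proof.
move=> ie B mB; have := mutually_independent_cons ie measurableT mB.
by rewrite preimage_setT setTI probability_setT mul1e jointly_box.
Qed.

(** For fixed [A] both sides are finite measures in [B], and they agree on boxes by
    [mutually_independent_cons]. *)
Lemma independent_head_tail n (e : 'I_n.+1 -> T -> R) :
  (forall i, measurable_fun setT (e i)) -> mutually_independent P e ->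
  forall (A : set R) (B : set (n.-tuple R)), measurable A -> measurable B ->
  P ((e ord0 @^-1` A) `&` (jointly (tail e) @^-1` B)) =
  (P (e ord0 @^-1` A) * P (jointly (tail e) @^-1` B))%E.
Proof.
move=> me ie A B mA mB.
have mt : measurable_fun setT (jointly (tail e)) by apply: measurable_jointly => i; exact: me.
have mA0 : measurable (e ord0 @^-1` A) by rewrite -[X in measurable X]setTI; exact: me.
pose F : {mfun T >-> n.-tuple R} := HB.pack (jointly (tail e)) (isMeasurableFun.Build _ _ _ _ _ mt).
have fA : P (e ord0 @^-1` A) \is a fin_num by exact: fin_num_measure.
have [k kE] : exists k : {nonneg R}, k%:num%:E = P (e ord0 @^-1` A).
  have h : 0 <= fine (P (e ord0 @^-1` A)) by rewrite fine_ge0.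
  by exists (NngNum h); rewrite /= fineK.
pose m1 := pushforward (mrestr P mA0) F.
pose m2 := mscale k (distribution P F).
have /= := @eq_measure_tuple R n m1 m2.
rewrite /m1 /m2 /mscale /= /distribution /pushforward /mrestr.
rewrite kE => H; rewrite setIC; apply: H => //.
  by rewrite preimage_setT setTI -kE ltry.
move=> C mC; rewrite setIC mutually_independent_cons//; congr (_ * _)%E.
by rewrite -(mutually_independent_tail ie)// -jointly_box.
Qed.

(** The joint law of head and tail is the product of their laws, so Tonelli allows the two to be
    integrated separately; inductions on the number of variables rest on this. *)
Lemma ge0_integral_independent n (e : 'I_n.+1 -> T -> R) :
  (forall i, measurable_fun setT (e i)) -> mutually_independent P e ->
  forall f : R * n.-tuple R -> \bar R, measurable_fun setT f -> (forall z, 0 <= f z)%E ->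
  (\int[P]_w f (e ord0 w, jointly (tail e) w) =
   \int[P]_w' \int[P]_w f (e ord0 w', jointly (tail e) w))%E.
Proof.
move=> me ie f mf f0.
have mt : measurable_fun setT (jointly (tail e)) by apply: measurable_jointly => i; exact: me.
pose F : {mfun T >-> n.-tuple R} := HB.pack (jointly (tail e)) (isMeasurableFun.Build _ _ _ _ _ mt).
pose E : {mfun T >-> R} := HB.pack (e ord0) (isMeasurableFun.Build _ _ _ _ _ (me ord0)).
have mEF : measurable_fun setT (fun w => (e ord0 w, jointly (tail e) w)).
  exact: measurable_fun_pair.
pose EF : {mfun T >-> (R * n.-tuple R)%type} :=
  HB.pack (fun w => (e ord0 w, jointly (tail e) w)) (isMeasurableFun.Build _ _ _ _ _ mEF).
pose PE : probability _ R := distribution P E.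
pose PF : probability _ R := distribution P F.
have PEF X : measurable X -> (PE \x PF)%E X = pushforward P EF X.
  apply: product_measure_unique => A B mA mB.
  exact: independent_head_tail.
transitivity (\int[pushforward P EF]_z f z)%E.
  by rewrite ge0_integral_pushforward.
transitivity (\int[PE \x PF]_z f z)%E.
  by apply: eq_measure_integral => A mA _; rewrite /= PEF.
rewrite fubini_tonelli1// /fubini_F.
rewrite ge0_integral_pushforward//.
- rewrite preimage_setT; apply: eq_integral => w _ /=.
  rewrite ge0_integral_pushforward//.
  exact: measurableT_comp.
- exact: measurable_fun_fubini_tonelli_F.
- by move=> x _; apply: integral_ge0.
Qed.

End independence.

Section tuples.
Context {R : realType}.

Definition shift n (h : 'I_n -> R) (t : n.-tuple R) : n.-tuple R :=
  [tuple tnth t i + h i | i < n].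

Lemma measurable_tuple_shift n (h : 'I_n -> R) : measurable_fun setT (shift h).
Proof.
apply/measurable_fun_tnthP => i.
rewrite (_ : _ \o _ = fun t => tnth t i + h i); last first.
  by apply/funext => t /=; rewrite tnth_mktuple.
by apply: measurable_funD => //; exact: measurable_tnth.
Qed.

Lemma measurable_sum_tnth n (c : 'I_n -> R) :
  measurable_fun setT (fun t : n.-tuple R => \sum_(i < n) c i * tnth t i).
Proof.
apply: measurable_sum => i; apply: measurable_funM => //.
exact: measurable_tnth.
Qed.

(** Density of the law of [n] independent centred normal variables of variance [s ^+ 2], shifted by
    [h], with respect to the unshifted law. *)
Definition gauss_tilt n (s : R) (h : 'I_n -> R) (t : n.-tuple R) : R :=
  expR (\sum_(i < n) (h i * tnth t i / s ^+ 2 - h i ^+ 2 / (s ^+ 2 *+ 2))).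

Lemma measurable_gauss_tilt n (s : R) (h : 'I_n -> R) : measurable_fun setT (gauss_tilt s h).
Proof.
apply: measurableT_comp => //; apply: measurable_sum => i.
apply: measurable_funB => //; apply: measurable_funM => //.
by apply: measurable_funM => //; exact: measurable_tnth.
Qed.

Definition cons_tuple_pair n (z : R * n.-tuple R) : n.+1.-tuple R := [tuple of z.1 :: z.2].

Lemma measurable_cons_pair n : measurable_fun setT (@cons_tuple_pair n).
Proof. exact: measurable_cons. Qed.

Lemma shift_cons n (h : 'I_n.+1 -> R) (z : R * n.-tuple R) :
  shift h (cons_tuple_pair z) =
  cons_tuple_pair (z.1 + h ord0, shift (fun i => h (lift ord0 i)) z.2).
Proof.
apply: eq_from_tnth => i; rewrite tnth_mktuple.
by case: (unliftP ord0 i) => [j ->|->]; rewrite /cons_tuple_pair ?tnth0 ?tnthS//= tnth_mktuple.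
Qed.

Lemma gauss_tilt_cons n (s : R) (h : 'I_n.+1 -> R) (z : R * n.-tuple R) :
  gauss_tilt s h (cons_tuple_pair z) =
  expR (h ord0 * z.1 / s ^+ 2 - h ord0 ^+ 2 / (s ^+ 2 *+ 2)) *
  gauss_tilt s (fun i => h (lift ord0 i)) z.2.
Proof.
rewrite /gauss_tilt big_ord_recl expRD /cons_tuple_pair tnth0; congr (_ * expR _).
by apply: eq_bigr => i _; rewrite tnthS.
Qed.

End tuples.

Section gaussian_family.
Context {R : realType} d (T : measurableType d) (P : probability T R).

Lemma jointly_cons n (e : 'I_n.+1 -> T -> R) w :
  jointly e w = cons_tuple_pair (e ord0 w, jointly (tail e) w).
Proof.
apply: eq_from_tnth => i; rewrite tnth_mktuple.
by case: (unliftP ord0 i) => [j ->|->]; rewrite /cons_tuple_pair ?tnth0 ?tnthS//= tnth_mktuple.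
Qed.

Lemma ge0_integral_law (X : T -> R) (m : {measure set (measurableTypeR R) -> \bar R}) (f : R -> \bar R) :
  measurable_fun setT X -> (forall B, measurable B -> P (X @^-1` B) = m B) ->
  measurable_fun setT f -> (forall x, 0 <= f x)%E ->
  (\int[P]_w f (X w) = \int[m]_x f x)%E.
Proof.
move=> mX PX mf f0.
pose F : {mfun T >-> measurableTypeR R} :=
  HB.pack X (isMeasurableFun.Build _ _ T (measurableTypeR R) X mX).
transitivity (\int[pushforward P F]_x f x)%E; first by rewrite ge0_integral_pushforward.
by apply: eq_measure_integral => A mA _; exact: PX.
Qed.

(** Induction on [n]: with the first coordinate frozen, the induction hypothesis removes the shift
    of the tail; the one-dimensional formula then removes the shift of the head, and the two
    densities multiply. *)
Lemma cameron_martin (s : R) n (e : 'I_n -> T -> R) (h : 'I_n -> R) (f : n.-tuple R -> \bar R) :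
  s != 0 -> (forall i, measurable_fun setT (e i)) ->
  (forall i B, measurable B -> P (e i @^-1` B) = normal_prob 0 s B) ->
  mutually_independent P e ->
  measurable_fun setT f -> (forall t, 0 <= f t)%E ->
  (\int[P]_w f (shift h (jointly e w)) =
   \int[P]_w (f (jointly e w) * (gauss_tilt s h (jointly e w))%:E))%E.
Proof.
move=> s0; elim: n => [|n IH] in e h f *; move=> me le ie mf f0.
  apply: eq_integral => w _.
  by rewrite [shift _ _]tuple0 [jointly _ _]tuple0 /gauss_tilt big_ord0 expR0 mule1.
have mt : forall i, measurable_fun setT (tail e i) by move=> i; exact: me.
have mjt := measurable_jointly mt.
have lt : forall i B, measurable B -> P (tail e i @^-1` B) = normal_prob 0 s B.
  by move=> i B mB; exact: le.
have it := mutually_independent_tail ie.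
pose h' (i : 'I_n) := h (lift ord0 i).
pose k x := expR (h ord0 * x / s ^+ 2 - h ord0 ^+ 2 / (s ^+ 2 *+ 2)).
have mk : measurable_fun setT k.
  apply: measurableT_comp => //; apply: measurable_funB => //.
  by apply: measurable_funM => //; apply: measurable_funM.
pose g (z : R * n.-tuple R) := (f (cons_tuple_pair z) * (gauss_tilt s h' z.2)%:E)%E.
have mfc : measurable_fun setT (f \o @cons_tuple_pair R n).
  by apply: measurableT_comp => //; exact: measurable_cons_pair.
have mg : measurable_fun setT g.
  apply: emeasurable_funM => //.
  by apply/measurable_EFinP; apply: measurableT_comp => //; exact: measurable_gauss_tilt.
have g0 z : (0 <= g z)%E by rewrite mule_ge0// lee_fin expR_ge0.
have mG : measurable_fun setT (fun x : R => \int[P]_w g (x, jointly (tail e) w))%E.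
  pose g' (z : R * T) := g (z.1, jointly (tail e) z.2).
  have mg' : measurable_fun setT g'.
    apply: measurableT_comp => //; apply: measurable_fun_pair => //.
    exact: measurableT_comp.
  exact: (measurable_fun_fubini_tonelli_F (m2 := P) g' mg' (fun z => g0 _)).
transitivity (\int[P]_w' \int[P]_w g ((e ord0 w' + h ord0)%R, jointly (tail e) w))%E.
  pose f1 (z : R * n.-tuple R) := f (cons_tuple_pair (z.1 + h ord0, shift h' z.2)).
  have mf1 : measurable_fun setT f1.
    apply: (measurableT_comp mfc); apply: measurable_fun_pair => /=.
      by apply: measurable_funD.
    by apply: measurableT_comp => //; exact: measurable_tuple_shift.
  transitivity (\int[P]_w f1 (e ord0 w, jointly (tail e) w))%E.
    by apply: eq_integral => w _; rewrite jointly_cons shift_cons.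
  rewrite (ge0_integral_independent me ie mf1 (fun z => f0 _)).
  apply: eq_integral => w' _.
  apply: (IH (tail e) h' (fun t => f (cons_tuple_pair (e ord0 w' + h ord0, t)))) => //.
  apply: (measurableT_comp mfc (_ : measurable_fun setT (pair (e ord0 w' + h ord0)))).
  exact: pair1_measurable.
pose G (x : R) : \bar R := (\int[P]_w g (x, jointly (tail e) w))%E.
have G0 x : (0 <= G x)%E by apply: integral_ge0.
transitivity (\int[P]_w' (G (e ord0 w') * (k (e ord0 w'))%:E))%E.
  have mGh : measurable_fun setT (fun x : R => G (x + h ord0)).
    by apply: measurableT_comp => //; exact: measurable_funD.
  rewrite (ge0_integral_law (m := normal_prob 0 s) (me ord0) (le ord0) mGh)//.
  rewrite ge0_integral_normal_prob_shift//.
  apply/esym; apply: (ge0_integral_law (m := normal_prob 0 s) (f := fun x => (G x * (k x)%:E)%E) (me ord0) (le ord0)).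
    by apply: emeasurable_funM => //; apply/measurable_EFinP.
  by move=> x; rewrite mule_ge0// lee_fin expR_ge0.
pose f2 (z : R * n.-tuple R) := (g z * (k z.1)%:E)%E.
have mf2 : measurable_fun setT f2.
  by apply: emeasurable_funM => //; apply/measurable_EFinP; exact: measurableT_comp.
transitivity (\int[P]_w f2 (e ord0 w, jointly (tail e) w))%E; last first.
  apply: eq_integral => w _; rewrite /f2 /g !jointly_cons gauss_tilt_cons/=.
  by rewrite -muleA -EFinM; congr (_ * _%:E)%E; exact: mulrC.
rewrite ge0_integral_independent//; last first.
  by move=> z; rewrite mule_ge0// lee_fin expR_ge0.
apply: eq_integral => w' _.
rewrite /G -ge0_integralZr//.
- apply: (measurableT_comp mg); apply: measurable_fun_pair => //.
- by rewrite lee_fin expR_ge0.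
Qed.

End gaussian_family.

(** * Linear images of independent normal variables *)

Section gauss0_law.
Context {R : realType}.

Lemma normal_prob_integral_indic (m s : R) (B : set R) : measurable B ->
  normal_prob m s B = (\int[normal_prob m s]_x (\1_B x)%:E)%E.
Proof. by move=> mB; rewrite integral_indic// setIT. Qed.

Lemma measurable_preimage_affine (a b : R) (B : set R) : measurable B ->
  measurable ((fun y : R => a * y + b) @^-1` B).
Proof.
move=> mB; rewrite -[X in measurable X]setTI.
by apply: (_ : measurable_fun setT (fun y : R => a * y + b)) => //; exact: measurable_affine.
Qed.

(** [gauss0] is a point mass at variance zero, so [c = 0] and [v = 0] are separate cases: a constant
    integrand and a pure scaling. Otherwise this is scaling followed by convolution of normal
    laws. *)
Lemma gauss0_conv (s c v : R) (B : set R) : 0 < s -> 0 <= v -> measurable B ->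
  (\int[normal_prob 0 s]_x gauss0 v ((fun y => y + c * x)%R @^-1` B) =
   gauss0 (c ^+ 2 * s ^+ 2 + v) B)%E.
Proof.
move=> s0 v0 mB.
have mBa (b : R) : measurable ((fun y : R => y + b) @^-1` B).
  have := measurable_preimage_affine 1 b mB.
  by under [X in X @^-1` _]funext do rewrite mul1r.
have [->|c0] := eqVneq c 0.
  under eq_integral => x _.
    rewrite (_ : _ @^-1` B = B); last first.
      by apply/seteqP; split => y /=; rewrite mul0r addr0.
    over.
  rewrite expr0n/= mul0r add0r integral_cst//= [X in (_ * X)%E](_ : _ = 1%E) ?mule1//.
  exact: probability_setT.
have mi : measurable_fun setT (fun x : R => (\1_B x)%:E : \bar R).
  exact/measurable_EFinP/measurable_indic.
have i0 (x : R) : (0 <= (\1_B x)%:E :> \bar R)%E by rewrite lee_fin.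
have cs0 : 0 < c ^+ 2 * s ^+ 2 by rewrite -exprMn exprn_even_gt0 //= mulf_neq0 // gt_eqF.
have sn0 : s != 0 by rewrite gt_eqF.
have csn0 : c * s != 0 by rewrite mulf_neq0.
(* [c] may be negative while [Num.sqrt] is not; the normal law depends on its scale only through the
   square. *)
have npE (t u : R) : t != 0 -> u != 0 -> t ^+ 2 = u ^+ 2 -> normal_prob 0 t = normal_prob 0 u.
  move=> t0 u0 tu; apply/funext => A; apply: eq_integral => x _.
  by rewrite !normal_pdfE// /normal_peak /normal_fun tu.
have csv : 0 < c ^+ 2 * s ^+ 2 + v by rewrite ltr_pwDl.
rewrite [in RHS]/gauss0 (gt_eqF csv).
have [->|vn0] := eqVneq v 0.
  rewrite addr0 (_ : normal_prob 0 (Num.sqrt _) = normal_prob 0 (c * s)); last first.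
    by apply: npE => //; rewrite ?gt_eqF ?sqrtr_gt0// sqr_sqrtr ?ltW// exprMn.
  apply/esym; apply: etrans (normal_prob_integral_indic 0 (c * s) mB) _.
  apply: etrans (esym (ge0_integral_normal_prob_scale sn0 c0 mi i0)) _; apply/esym.
  apply: eq_integral => x _.
  rewrite /gauss0 eqxx diracE indicE; congr (nat_of_bool _)%:R%:E.
  by apply/idP/idP; rewrite !inE/= add0r.
have vp : 0 < v by rewrite lt_neqAle eq_sym vn0.
rewrite (_ : normal_prob 0 (Num.sqrt _) = normal_prob 0 (Num.sqrt ((c * s) ^+ 2 + Num.sqrt v ^+ 2))); last first.
  by congr (normal_prob 0 (Num.sqrt _)); rewrite sqr_sqrtr// exprMn.
have sv : Num.sqrt v != 0 by rewrite gt_eqF// sqrtr_gt0.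
apply/esym; apply: etrans (normal_prob_integral_indic 0 _ mB) _.
apply: etrans (esym (normal_prob_conv csn0 sv mi i0)) _; apply/esym.
pose g (x : R) := (\int[normal_prob 0 (Num.sqrt v)]_y (\1_B (x + y)%R)%:E : \bar R)%E.
have mg : measurable_fun setT g.
  pose k (z : R * R) := ((\1_B (z.1 + z.2)%R)%:E : \bar R).
  have mk : measurable_fun setT k.
    by apply: (measurableT_comp mi); exact: measurable_funD.
  exact: (measurable_fun_fubini_tonelli_F (m2 := normal_prob 0 (Num.sqrt v)) k mk (fun z => i0 _)).
have g0 x : (0 <= g x)%E by apply: integral_ge0.
apply: etrans (ge0_integral_normal_prob_scale sn0 c0 mg g0).
apply: eq_integral => x _; rewrite /gauss0 (negbTE vn0).
apply: etrans (normal_prob_integral_indic 0 _ (mBa _)) _.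
by apply: eq_integral => y _; rewrite /= /indic/= [c * x + y]addrC.
Qed.

End gauss0_law.

Section gaussian_sums.
Context {R : realType} d (T : measurableType d) (P : probability T R).

Lemma probability_integral_indic (A : set T) : measurable A ->
  P A = (\int[P]_w (\1_A w)%:E)%E.
Proof. by move=> mA; rewrite integral_indic// setIT. Qed.

(** Induction on [n]: once the first variable is fixed, its contribution merely translates [B], and
    [gauss0_conv] adds its variance. *)
Lemma gauss0_linear_combination (s : R) n (e : 'I_n -> T -> R) (c : 'I_n -> R) (B : set R) :
  0 < s -> (forall i, measurable_fun setT (e i)) ->
  (forall i B, measurable B -> P (e i @^-1` B) = normal_prob 0 s B) ->
  mutually_independent P e -> measurable B ->
  P ((fun w => \sum_(i < n) c i * e i w) @^-1` B) =
  gauss0 (\sum_(i < n) c i ^+ 2 * s ^+ 2) B.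
Proof.
move=> s0; elim: n => [|n IH] in e c B *; move=> me le ie mB.
  rewrite big_ord0 /gauss0 eqxx diracE.
  under [X in X @^-1` _]funext do rewrite big_ord0.
  rewrite preimage_cst; case: ifPn => _; first by rewrite probability_setT.
  by rewrite measure0.
have mt : forall i, measurable_fun setT (tail e i) by move=> i; exact: me.
have lt : forall i B, measurable B -> P (tail e i @^-1` B) = normal_prob 0 s B.
  by move=> i C mC; exact: le.
have it := mutually_independent_tail ie.
have mjt := measurable_jointly mt.
pose f (z : R * n.-tuple R) : \bar R :=
  (\1_B (c ord0 * z.1 + \sum_(i < n) c (lift ord0 i) * tnth z.2 i))%:E.
have mf : measurable_fun setT f.
  have mi : measurable_fun setT (fun x : R => (\1_B x)%:E : \bar R).
    exact/measurable_EFinP/measurable_indic.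
  apply: (measurableT_comp mi); apply: measurable_funD; first exact: measurable_funM.
  exact: (measurableT_comp (measurable_sum_tnth (fun i => c (lift ord0 i)))).
have f0 z : (0 <= f z)%E by rewrite lee_fin.
have mS : measurable_fun setT (fun w => \sum_(i < n.+1) c i * e i w).
  by apply: measurable_sum => i; exact: measurable_funM.
transitivity (\int[P]_w f (e ord0 w, jointly (tail e) w))%E.
  rewrite probability_integral_indic; last by rewrite -[X in measurable X]setTI; exact: mS.
  apply: eq_integral => w _.
  transitivity ((\1_B (\sum_(i < n.+1) c i * e i w))%:E : \bar R); first by rewrite !indicE.
  rewrite /f/= big_ord_recl.
  by under [in RHS]eq_bigr do rewrite tnth_mktuple.
rewrite ge0_integral_independent//.
have mG : measurable_fun setT (fun x : R => \int[P]_w f (x, jointly (tail e) w))%E.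
  pose g' (z : R * T) := f (z.1, jointly (tail e) z.2).
  have mg' : measurable_fun setT g'.
    apply: measurableT_comp => //; apply: measurable_fun_pair => //.
    exact: measurableT_comp.
  exact: (measurable_fun_fubini_tonelli_F (m2 := P) g' mg' (fun z => f0 _)).
apply: etrans (ge0_integral_law (m := normal_prob 0 s) (me ord0) (le ord0) mG _) _.
  by move=> x; exact: integral_ge0.
rewrite big_ord_recl -gauss0_conv//; last first.
  by apply: sumr_ge0 => i _; rewrite mulr_ge0 ?sqr_ge0.
apply: eq_integral => x _.
have mBx : measurable ((fun y : R => y + c ord0 * x) @^-1` B).
  have := measurable_preimage_affine 1 (c ord0 * x) mB.
  by under [X in X @^-1` _]funext do rewrite mul1r.
have := IH (tail e) (fun i => c (lift ord0 i)) _ mt lt it mBx.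
move=> <-.
have mS' : measurable_fun setT (fun w => \sum_(i < n) c (lift ord0 i) * tail e i w).
  by apply: measurable_sum => i; exact: measurable_funM.
rewrite [RHS]probability_integral_indic; last by rewrite -[X in measurable X]setTI; exact: mS'.
apply: eq_integral => w _.
transitivity ((\1_B (\sum_(i < n) c (lift ord0 i) * tail e i w + c ord0 * x))%:E : \bar R);
  last by rewrite !indicE.
by rewrite /f/=; under eq_bigr do rewrite tnth_mktuple; rewrite addrC.
Qed.

(** A projection of the image along [c] is the projection of the noise along [c^T A], whose squared
    norm is the quadratic form of [A *m A^T] at [c]. *)
Lemma gaussian_vector_linear_image (s : R) n p (e : 'I_n -> T -> R) (A : 'M[R]_(p, n)) :
  0 < s -> (forall i, measurable_fun setT (e i)) ->
  (forall i B, measurable B -> P (e i @^-1` B) = normal_prob 0 s B) ->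
  mutually_independent P e ->
  gaussian_vector P (fun j w => \sum_(i < n) A j i * e i w) (s ^+ 2 *: (A *m A^T)).
Proof.
move=> s0 me le ie; split.
  by move=> j; apply: measurable_sum => i; exact: measurable_funM.
move=> c B mB.
have := gauss0_linear_combination (fun i => \sum_(j < p) c j * A j i) s0 me le ie mB.
rewrite (_ : (fun w => _) = (fun w => \sum_(j < p) c j * \sum_(i < n) A j i * e i w)); last first.
  apply/funext => w; under eq_bigr do rewrite mulr_suml.
  rewrite exchange_big/=; apply: eq_bigr => j _; rewrite mulr_sumr.
  by apply: eq_bigr => i _; rewrite mulrA.
move=> ->; congr (gauss0 _ B).
under [RHS]eq_bigr => j _.
  under eq_bigr => k _.
    rewrite !mxE mulr_sumr mulr_sumr mulr_suml.
    under eq_bigr do rewrite mxE.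
    over.
  rewrite exchange_big/=.
  over.
rewrite exchange_big/=; apply: eq_bigr => i _.
rewrite expr2 mulr_suml mulr_suml; apply: eq_bigr => j _.
rewrite mulr_sumr mulr_suml; apply: eq_bigr => k _.
by ring.
Qed.

End gaussian_sums.

(** * Anticoncentration of Gaussian maxima *)

Section comparison_sets.
Context {R : realType} d (T : measurableType d).
Implicit Types f g : T -> R.

Lemma measurable_ltr_set f g : measurable_fun setT f -> measurable_fun setT g ->
  measurable [set x | f x < g x].
Proof.
move=> mf mg; rewrite -[X in measurable X]setTI.
exact: (measurable_fun_ltr mf mg measurableT (_ : measurable [set true])).
Qed.

Lemma measurable_ler_set f g : measurable_fun setT f -> measurable_fun setT g ->
  measurable [set x | f x <= g x].
Proof.
move=> mf mg; rewrite -[X in measurable X]setTI.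
exact: (measurable_fun_ler mf mg measurableT (_ : measurable [set true])).
Qed.

End comparison_sets.

Section anticoncentration.
Context {R : realType} d (T : measurableType d) (P : probability T R).
Variables (s : R) (n : nat) (e : 'I_n -> T -> R).
Hypotheses (s0 : 0 < s) (me : forall i, measurable_fun setT (e i)).
Hypothesis le_e : forall i B, measurable B -> P (e i @^-1` B) = normal_prob 0 s B.
Hypothesis ie : mutually_independent P e.
Variables (q : nat) (c : 'I_q -> 'I_n -> R) (D : 'I_q -> R).
Hypothesis unit_variance : forall k, \sum_(i < n) c k i ^+ 2 * s ^+ 2 = 1.
Hypothesis D_ge0 : forall k, 0 <= D k.

Let V (k : 'I_q) (t : n.-tuple R) : R := \sum_(i < n) c k i * tnth t i + D k.

Let mV k : measurable_fun setT (V k).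
Proof. by apply: measurable_funD => //; exact: measurable_sum_tnth. Qed.

(* ties are broken by the smallest index, so that these sets are disjoint in [k] *)
Let first_max (k : 'I_q) (lo hi : R) : set (n.-tuple R) :=
  [set t | lo < V k t <= hi] `&`
  \bigcap_(l in [set: 'I_q]) [set t | if (l < k)%N then V l t < V k t else V l t <= V k t].

(** The event that the largest [V k] lies in []lo, hi]], written as a difference of two tail events
    so that its probabilities telescope. *)
Let max_in (lo hi : R) : set (n.-tuple R) :=
  [set t | exists k, lo < V k t] `\` [set t | exists k, hi < V k t].

Let measurable_above (x : R) : measurable [set t | exists k, x < V k t].
Proof.
rewrite (_ : mkset _ = \bigcup_(k in [set: 'I_q]) [set t | x < V k t]); last first.
  by apply/seteqP; split => [t [k xk]|t [k _ xk]]; exists k.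
apply: fin_bigcup_measurable => // k _.
exact: (measurable_ltr_set (f := cst x)).
Qed.

Let measurable_first_max k lo hi : measurable (first_max k lo hi).
Proof.
apply: measurableI.
  rewrite (_ : mkset _ = [set t | lo < V k t] `&` [set t | V k t <= hi]).
    by apply: measurableI; [exact: (measurable_ltr_set (f := cst lo))|exact: (measurable_ler_set (g := cst hi))].
  by apply/seteqP; split => t /= => [/andP[]|[-> ->]].
apply: fin_bigcap_measurable => // l _; case: (l < k)%N.
- exact: measurable_ltr_set.
- exact: measurable_ler_set.
Qed.

(** [r] times the covariance vector of the noise with the linear form of [V k]; as that form has
    variance one, [V k] rises by exactly [r]. *)
Let drift (r : R) (k : 'I_q) (i : 'I_n) := r * s ^+ 2 * c k i.

Let sq_sum k : \sum_(i < n) c k i ^+ 2 = (s ^+ 2)^-1.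
Proof.
have := unit_variance k; rewrite -mulr_suml => /(canRL (mulfK _)) ->; rewrite ?mul1r//.
by rewrite expf_eq0/= gt_eqF.
Qed.

Let V_drift_self (r : R) k t : V k (shift (drift r k) t) = V k t + r.
Proof.
rewrite /V addrAC; congr (_ + _).
under eq_bigr do rewrite tnth_mktuple mulrDr.
rewrite big_split/=; congr (_ + _).
under eq_bigr do rewrite /drift mulrCA -expr2.
by rewrite -mulr_sumr sq_sum mulfK// expf_eq0/= gt_eqF.
Qed.

(* a unit vector maximises its own inner product among unit vectors *)
Let V_drift (r : R) k l t : 0 <= r -> V l (shift (drift r k) t) <= V l t + r.
Proof.
move=> r0; rewrite /V addrAC lerD2r.
under eq_bigr do rewrite tnth_mktuple mulrDr.
rewrite big_split/= lerD2l.
under eq_bigr do rewrite /drift mulrCA.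
rewrite -mulr_sumr.
have s2 : 0 < s ^+ 2 by rewrite exprn_gt0.
suff H : \sum_(i < n) c l i * c k i <= (s ^+ 2)^-1.
  by rewrite -mulrA ler_piMr// mulrC -ler_pdivlMr// mul1r.
have H2 : \sum_(i < n) (c l i * c k i) *+ 2 <= \sum_(i < n) (c l i ^+ 2 + c k i ^+ 2).
  apply: ler_sum => i _; have := sqr_ge0 (c l i - c k i); nra.
move: H2; rewrite sumrMnl big_split/= !sq_sum; lra.
Qed.

(** [V k] gains [r] and every other coordinate at most [r], so both the strict and the weak
    comparisons survive the shift. *)
Let first_max_shift (r : R) k lo hi t : 0 <= r -> first_max k lo hi t ->
  first_max k (lo + r) (hi + r) (shift (drift r k) t).
Proof.
move=> r0 [/= /andP[lt1 le2] H]; split => /=; first by rewrite V_drift_self ltrD2r lerD2r lt1.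
move=> l _ /=; rewrite V_drift_self; have := H l I; have := V_drift k l t r0 => /=.
by case: ifP => _; lra.
Qed.

(** By Cameron-Martin the cost of the shift is the tilt on the target slab. Its exponent there is
    [r * (V k - D k) - r ^+ 2 / 2], at most [r * (hi + r)] because [V k <= hi + r] and
    [D k >= 0]. *)
Let probability_first_max (r : R) k lo hi : 0 <= r ->
  (P (jointly e @^-1` first_max k lo hi) <=
   (expR (r * (hi + r)))%:E * P (jointly e @^-1` first_max k (lo + r) (hi + r)))%E.
Proof.
move=> r0.
have mj := measurable_jointly me.
have mA lo' hi' : measurable (jointly e @^-1` first_max k lo' hi').
  by rewrite -[X in measurable X]setTI; exact: mj.
set A := first_max k lo hi; set B := first_max k (lo + r) (hi + r).
have mi (C : set (n.-tuple R)) : measurable C -> measurable_fun setT (fun t => (\1_C t)%:E : \bar R).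
  by move=> mC; apply/measurable_EFinP; exact: measurable_indic.
have mB : measurable B by exact: measurable_first_max.
have miB := mi _ mB.
have miBj : measurable_fun setT (fun w => (\1_B (jointly e w))%:E : \bar R).
  exact: (measurableT_comp miB).
have s_n0 : s != 0 by rewrite gt_eqF.
apply: (@le_trans _ _ (\int[P]_w (\1_B (shift (drift r k) (jointly e w)))%:E)%E).
  rewrite probability_integral_indic; last exact: mA.
  apply: ge0_le_integral => //.
  - exact: (measurableT_comp (mi _ (measurable_first_max k lo hi))).
  - apply: (measurableT_comp miB); apply: measurableT_comp mj.
    exact: measurable_tuple_shift.
  move=> w _; rewrite lee_fin !indicE.
  have [wA|] := boolP (w \in _); last by rewrite ler0n.
  by rewrite mem_set//; apply: first_max_shift => //; rewrite inE in wA.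
rewrite (cameron_martin (drift r k) s_n0 me le_e ie miB)//.
rewrite [in leRHS]probability_integral_indic; last exact: mA.
rewrite -ge0_integralZl//.
apply: ge0_le_integral => //.
- by move=> w _; rewrite mule_ge0// lee_fin expR_ge0.
- apply: emeasurable_funM => //; apply/measurable_EFinP.
  by apply: measurableT_comp mj; exact: measurable_gauss_tilt.
- by apply: emeasurable_funM.
move=> w _; rewrite -!EFinM lee_fin [leRHS]mulrC !indicE.
have -> : (w \in jointly e @^-1` B) = (jointly e w \in B) by [].
have [wB|] := boolP (jointly e w \in B); last by rewrite !mul0r.
rewrite !mul1r ler_expR.
have [/= /andP[_ hiV] _] : B (jointly e w) by rewrite inE in wB.
have s2 : 0 < s ^+ 2 by rewrite exprn_gt0.
rewrite big_split/= sumrN.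
have -> : \sum_(i < n) drift r k i * tnth (jointly e w) i / s ^+ 2 =
    r * (V k (jointly e w) - D k).
  rewrite /V addrK mulr_sumr; apply: eq_bigr => i _.
  by rewrite /drift; field; rewrite gt_eqF.
have -> : \sum_(i < n) drift r k i ^+ 2 / (s ^+ 2 *+ 2) = r ^+ 2 / 2.
  rewrite (eq_bigr (fun i => r ^+ 2 / 2 * (c k i ^+ 2 * s ^+ 2))) => [|i _].
    by rewrite -mulr_sumr unit_variance mulr1.
  by rewrite /drift; field; rewrite gt_eqF.
have := D_ge0 k; have := sqr_ge0 r; nra.
Qed.

Let max_in_bigcup lo hi : max_in lo hi = \bigcup_(k in [set: 'I_q]) first_max k lo hi.
Proof.
apply/seteqP; split => t; last first.
  move=> [k _ [/= /andP[lok khi] H]]; split; first by exists k.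
  move=> [l hil]; have := H l I => /=; case: ifP => _ Hl; first by have := lt_trans hil Hl; rewrite ltNge khi.
  by have := lt_le_trans hil Hl; rewrite ltNge khi.
move=> [[k0 lok0] nhi].
(* [k1] is an arbitrary maximiser, [k2] the maximiser of smallest index, as the tie-breaking rule
   demands. *)
pose k1 := [arg max_(k > k0) V k t]%O.
have k1P l : V l t <= V k1 t by rewrite /k1; case: arg_maxP => // i _; exact.
pose k2 := [arg min_(k < k1 | [forall l, (V l t <= V k t)%R]) (k : nat)]%N.
have [k2P k2min] : (forall l, V l t <= V k2 t) /\
    (forall j, (forall l, V l t <= V j t) -> (k2 <= j)%N).
  rewrite /k2; case: arg_minnP => [|i /forallP iP imin]; first by apply/forallP.
  by split=> // j jP; apply: imin; apply/forallP.
exists k2 => //; split => /=.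
  rewrite (lt_le_trans lok0)//= leNgt; apply/negP => h; apply: nhi; by exists k2.
move=> l _ /=; case: ifP => // lk2; rewrite lt_neqAle k2P andbT.
apply/negP => /eqP E; have := k2min l; rewrite E leqNgt lk2 => /(_ k2P).
by [].
Qed.

Let trivIset_first_max lo hi : trivIset setT (fun k => jointly e @^-1` first_max k lo hi).
Proof.
move=> k l _ _ [w [[_ Hk] [_ Hl]]]; apply/val_inj/eqP; rewrite eqn_leq.
have := Hk l I; have := Hl k I => /=.
case: ltnP => kl; case: ltnP => lk //= h1 h2.
- by have := ltn_trans kl lk; rewrite ltnn.
- by have := lt_le_trans h1 h2; rewrite ltxx.
- by have := lt_le_trans h2 h1; rewrite ltxx.
Qed.

Let probability_max_in lo hi : (P (jointly e @^-1` max_in lo hi) =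
  \sum_(k < q) P (jointly e @^-1` first_max k lo hi))%E.
Proof.
have mj := measurable_jointly me.
rewrite max_in_bigcup preimage_bigcup -(measure_bigsetU_ord P xpredT)//.
- congr (P _); apply/seteqP; split => w.
    by move=> [k _ wk]; rewrite -bigcup_seq; exists k => //=; rewrite mem_index_enum.
  by rewrite -bigcup_seq => -[k _ wk]; exists k.
- by move=> k; rewrite -[X in measurable X]setTI; exact: mj.
Qed.

Let F (x : R) := fine (P (jointly e @^-1` [set t | exists k, x < V k t])).

Let probability_max_inE lo hi : lo <= hi ->
  P (jointly e @^-1` max_in lo hi) = (F lo - F hi)%:E.
Proof.
move=> lohi; have mj := measurable_jointly me.
have mE x : measurable (jointly e @^-1` [set t | exists k, x < V k t]).
  by rewrite -[X in measurable X]setTI; exact: mj.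
transitivity (P ((jointly e @^-1` [set t | exists k, lo < V k t]) `\`
  (jointly e @^-1` [set t | exists k, hi < V k t]))); first by [].
rewrite measureD//; last first.
  by rewrite (le_lt_trans (probability_le1 _ _)) ?ltry.
rewrite setIidr; last by move=> w [k hk]; exists k; exact: le_lt_trans hk.
by rewrite EFinB !fineK// fin_num_measure.
Qed.

(** The [m] disjoint slabs of width [del] share a mass of at most one, and the first has at most
    [expR (u + 1)] times the mass of each: the shift lengths [r = i * del] are at most one, so
    [r * (u + r) <= u + 1]. Working with [m] instead of the inverse of [del] admits [del = 0]. *)
Lemma gaussian_max_anticoncentration (u del : R) (m : nat) :
  0 <= u -> 0 <= del -> (0 < m)%N -> m%:R * del <= 1 ->
  fine (P [set w | exists k, u - del < \sum_(i < n) c k i * e i w + D k]) <=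
  fine (P [set w | exists k, u < \sum_(i < n) c k i * e i w + D k]) + expR (u + 1) / m%:R.
Proof.
move=> u0 del0 m0 mdel.
have FE x : fine (P [set w | exists k, x < \sum_(i < n) c k i * e i w + D k]) = F x.
  rewrite /F; congr (fine (P _)); apply/seteqP; split => w [k]; rewrite /=.
    by move=> h; exists k => /=; rewrite /V; under eq_bigr do rewrite tnth_mktuple.
  by rewrite /V; under eq_bigr do rewrite tnth_mktuple; exists k.
rewrite !FE -lerBlDl.
have mn0 : 0 < m%:R :> R by rewrite ltr0n.
pose f i := F (u - del + i%:R * del).
have step (i : 'I_m) : F (u - del) - F u <= expR (u + 1) * (f i - f i.+1).
  have r0 : 0 <= i%:R * del by rewrite mulr_ge0.
  have r1 : i%:R * del <= 1.
    by apply: le_trans mdel; rewrite ler_wpM2r// ler_nat ltnW.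
  have lohi : u - del <= u by lra.
  have H := probability_max_inE lohi.
  have : ((F (u - del) - F u)%:E <= (expR (i%:R * del * (u + i%:R * del)))%:E *
     P (jointly e @^-1` max_in (u - del + i%:R * del) (u + i%:R * del)))%E.
    rewrite -H !probability_max_in ge0_sume_distrr//.
    by apply: lee_sum => k _; exact: probability_first_max.
  rewrite probability_max_inE; last by rewrite lerD2r.
  rewrite -EFinM lee_fin.
  (* Consecutive slabs abut, so the sum over [i] telescopes. *)
  have -> : u + i%:R * del = u - del + i.+1%:R * del by rewrite -addn1 natrD; ring.
  rewrite -/(f i) -/(f i.+1) => /le_trans; apply.
  have f0 : 0 <= f i - f i.+1.
    rewrite -lee_fin -probability_max_inE ?measure_ge0//.
    by rewrite -addn1 natrD; nra.
  rewrite ler_wpM2r// ler_expR -addn1 natrD; nra.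
have : \sum_(i < m) (F (u - del) - F u) <= \sum_(i < m) expR (u + 1) * (f i - f i.+1).
  by apply: ler_sum => i _; exact: step.
rewrite sumr_const card_ord -mulr_sumr => h.
have : (F (u - del) - F u) *+ m <= expR (u + 1).
  apply: le_trans h _; rewrite -[leRHS]mulr1 ler_wpM2l ?expR_ge0//.
  rewrite -(big_mkord xpredT (fun i => f i - f i.+1)).
  rewrite (@telescope_sumr_eq _ _ _ (fun i => - f i))//; last by move=> i _; ring.
  have F01 x : 0 <= F x <= 1.
    have mE : measurable (jointly e @^-1` [set t | exists k, x < V k t]).
      by rewrite -[X in measurable X]setTI; exact: measurable_jointly.
    by rewrite fine_ge0//= -lee_fin fineK ?fin_num_measure// probability_le1.
  have /andP[_ h1] := F01 (u - del + 0%:R * del).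
  have /andP[h2 _] := F01 (u - del + m%:R * del).
  by rewrite /f; lra.
by rewrite ler_pdivlMr// mulr_natr.
Qed.

End anticoncentration.

(** * Gaussian vectors are determined by their one-dimensional projections *)

Section indicator_limits.
Context {R : realType}.

Lemma bernoulli_ineq (x : R) n : -1 <= x -> 1 + n%:R * x <= (1 + x) ^+ n.
Proof.
move=> x1; elim: n => [|n IH]; first by rewrite mul0r addr0 expr0.
rewrite exprS -addn1 natrD.
have x0 : 0 <= 1 + x by lra.
apply: le_trans (ler_wpM2l x0 IH).
have := mulr_ge0 (ler0n R n) (sqr_ge0 x); nra.
Qed.

(** Split [q ^+ m] into two factors [a ^+ m] with [a] the square root of [q]: Bernoulli's inequality
    for [a^-1] bounds [m * a ^+ m], and the other factor tends to zero. *)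
Lemma cvg_mul_expr (q : R) : 0 <= q < 1 -> (fun m => m%:R * q ^+ m) @ \oo --> (0 : R).
Proof.
move=> /andP[q0 q1].
have [->|qn0] := eqVneq q 0.
  rewrite (_ : (fun _ => _) = cst 0); first exact: cvg_cst.
  apply/funext => -[|m]; rewrite ?mul0r//= exprS mul0r mulr0//.
have qp : 0 < q by rewrite lt_neqAle eq_sym qn0.
pose a := Num.sqrt q.
have a0 : 0 < a by rewrite sqrtr_gt0.
have a2 : a ^+ 2 = q by rewrite sqr_sqrtr.
have a1 : a < 1 by nra.
pose C := (a^-1 - 1)^-1.
have ia : 0 < a^-1 - 1 by rewrite subr_gt0 invf_gt1.
have bnd m : m%:R * a ^+ m <= C.
  have h : 1 + m%:R * (a^-1 - 1) <= (a ^+ m)^-1.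
    by rewrite -exprVn -[X in X ^+ m](subrKC 1); apply: bernoulli_ineq; lra.
  rewrite /C -[leRHS]mul1r ler_pdivlMr// -mulrA [a ^+ m * _]mulrC mulrA.
  have am : 0 < a ^+ m by rewrite exprn_gt0.
  by rewrite -ler_pdivlMr// mul1r; apply: le_trans h; rewrite lerDr.
apply: (@squeeze_cvgr _ _ _ _ (cst 0) (fun m => C * a ^+ m)).
- near=> m; rewrite mulr_ge0 ?exprn_ge0//= -a2 -exprM mulnC exprM expr2 mulrA.
  by rewrite ler_wpM2r ?exprn_ge0// ltW.
- exact: cvg_cst.
- rewrite -(mulr0 C); apply: cvgM; first exact: cvg_cst.
  by apply: cvg_expr; rewrite gtr0_norm.
Unshelve. all: by end_near.
Qed.

(* The exponent is about [m / r ^+ m], so that exponent times [y ^+ m] tends to 0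
   if [y < r] and is at least [m] otherwise, including at [y = r]. *)
Lemma cvg_step (y r : R) : 0 <= y <= 1 -> 0 < r <= 1 ->
  (fun m => (1 - y ^+ m) ^+ (Num.truncn (m%:R / r ^+ m)).+1) @ \oo --> ((y < r)%R%:R : R).
Proof.
move=> /andP[y0 y1] /andP[r0 r1].
pose N m := (Num.truncn (m%:R / r ^+ m)).+1.
have rm m : 0 < r ^+ m by rewrite exprn_gt0.
have ym m : 0 <= y ^+ m <= 1 by rewrite exprn_ge0// exprn_ile1.
have N_lb m : m%:R <= (N m)%:R * r ^+ m.
  by rewrite -ler_pdivrMr// ltW// /N truncnS_gt.
have N_ub m : (N m)%:R <= m%:R / r ^+ m + 1.
  by rewrite /N -addn1 natrD lerD2r truncn_le divr_ge0// ltW.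
have [yr|ry] := ltP y r.
  apply: (@squeeze_cvgr _ _ _ _ (fun m => 1 - (m%:R * (y / r) ^+ m + y ^+ m)) (cst 1)).
  - near=> m.
    have /andP[ym0 ym1] := ym m.
    apply/andP; split; last by rewrite exprn_ile1 ?subr_ge0 ?lerBlDr ?lerDl.
    have h : 1 + (N m)%:R * (- y ^+ m) <= (1 - y ^+ m) ^+ N m.
      by apply: bernoulli_ineq; lra.
    apply: le_trans h; rewrite lerD2l mulrN lerN2.
    apply: le_trans (ler_wpM2r ym0 (N_ub m)) _.
    by rewrite mulrDl mul1r lerD2r expr_div_n mulrAC mulrA.
  - rewrite -[X in _ --> X](subr0 1) -[X in _ --> _ - X](addr0 0).
    apply: cvgB; first exact: cvg_cst.
    apply: cvgD.
      by apply: cvg_mul_expr; rewrite divr_ge0 ?(ltW r0)//= ltr_pdivrMr// mul1r.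
    by apply: cvg_expr; rewrite ger0_norm// (lt_le_trans yr).
  - exact: cvg_cst.
apply: (@squeeze_cvgr _ _ _ _ (cst 0) (fun m => m.+1%:R^-1)).
- near=> m.
  have /andP[ym0 ym1] := ym m.
  rewrite exprn_ge0 ?subr_ge0//=.
  have h : 1 + (N m)%:R * y ^+ m <= (1 + y ^+ m) ^+ N m by apply: bernoulli_ineq; lra.
  (* Since [(1 - t) * (1 + t) <= 1], an upper bound for the power of [1 - t] follows from the
     Bernoulli lower bound for the power of [1 + t]. *)
  have h2 : (1 - y ^+ m) ^+ N m * (1 + y ^+ m) ^+ N m <= 1.
    rewrite -exprMn exprn_ile1//.
      by rewrite mulr_ge0 ?subr_ge0// addr_ge0.
    by rewrite -subr_sqr expr1n lerBlDr lerDl sqr_ge0.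
  have h3 : m.+1%:R <= (1 + y ^+ m) ^+ N m.
    apply: le_trans h; rewrite -addn1 natrD addrC lerD2l.
    apply: le_trans (N_lb m) _; rewrite ler_wpM2l//.
    by apply: lerXn2r => //; rewrite nnegrE ltW.
  rewrite -[leRHS]mul1r ler_pdivlMr//; apply: le_trans h2.
  by rewrite ler_wpM2l// exprn_ge0// subr_ge0.
- exact: cvg_cst.
- exact: cvg_harmonic.
Unshelve. all: by end_near.
Qed.

Lemma ltr_cos_scaled (L z t : R) : 0 < L -> `|z| <= pi * L -> 0 <= t <= pi * L ->
  (cos (t / L) < cos (z / L)) = (`|z| < t).
Proof.
move=> L0 zL /andP[t0 tL].
rewrite -[in LHS](cos_norm (z / L)) normrM (gtr0_norm (_ : 0 < L^-1)) ?invr_gt0//.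
rewrite ltr_cos ?in_itv/= ?ler_pdivrMr ?divr_ge0 ?(ltW L0)//.
by rewrite ltr_pM2r ?invr_gt0.
Qed.

End indicator_limits.

Section trigonometric_polynomials.
Context {R : realType} (I : finType).

(** Linear combinations of cosines of linear forms. Cosines alone suffice: they are closed under
    products up to linear combination, and the mean of each depends on the law of a single
    projection. *)
Inductive trig_poly : ((I -> R) -> R) -> Prop :=
| trig_poly_cos c : trig_poly (fun z => cos (\sum_i c i * z i))
| trig_poly_add f g : trig_poly f -> trig_poly g -> trig_poly (fun z => f z + g z)
| trig_poly_scale a f : trig_poly f -> trig_poly (fun z => a * f z).

Lemma trig_poly_cst a : trig_poly (fun=> a).
Proof.
rewrite (_ : (fun _ => _) = fun z : I -> R => a * cos (\sum_i 0 * z i)).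
  exact/trig_poly_scale/trig_poly_cos.
by apply/funext => z; rewrite big1 ?cos0 ?mulr1// => i _; rewrite mul0r.
Qed.

Lemma trig_poly_mul f g : trig_poly f -> trig_poly g -> trig_poly (fun z => f z * g z).
Proof.
move=> tf tg; elim: tf => [c|f1 f2 _ h1 _ h2|a f1 _ h1]; last 2 first.
- rewrite (_ : (fun _ => _) = fun z => f1 z * g z + f2 z * g z); first exact: trig_poly_add.
  by apply/funext => z; rewrite mulrDl.
- rewrite (_ : (fun _ => _) = fun z => a * (f1 z * g z)); first exact: trig_poly_scale.
  by apply/funext => z; rewrite mulrA.
elim: tg => [c'|g1 g2 _ h1 _ h2|a g1 _ h1]; last 2 first.
- rewrite (_ : (fun _ => _) = fun z => cos (\sum_i c i * z i) * g1 z + cos (\sum_i c i * z i) * g2 z).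
    exact: trig_poly_add.
  by apply/funext => z; rewrite mulrDr.
- rewrite (_ : (fun _ => _) = fun z => a * (cos (\sum_i c i * z i) * g1 z)).
    exact: trig_poly_scale.
  by apply/funext => z; rewrite mulrCA.
rewrite (_ : (fun _ => _) = fun z => 2^-1 * (cos (\sum_i (c i + c' i) * z i) +
    cos (\sum_i (c i - c' i) * z i))).
  by apply: trig_poly_scale; apply: trig_poly_add; exact: trig_poly_cos.
apply/funext => z.
under [in RHS]eq_bigr do rewrite mulrDl.
under [X in _ + cos X]eq_bigr do rewrite mulrBl.
rewrite big_split/= sumrB cosD cosB; lra.
Qed.

Lemma trig_poly_exp f m : trig_poly f -> trig_poly (fun z => f z ^+ m).
Proof.
move=> tf; elim: m => [|m IH]; first exact: trig_poly_cst.
rewrite (_ : (fun _ => _) = fun z => f z * f z ^+ m); first exact: trig_poly_mul.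
by apply/funext => z; rewrite exprS.
Qed.

Lemma trig_poly_prod (f : I -> (I -> R) -> R) (r : seq I) (p : pred I) :
  (forall i, trig_poly (f i)) -> trig_poly (fun z => \prod_(i <- r | p i) f i z).
Proof.
move=> tf; elim: r => [|i r IH].
  rewrite (_ : (fun _ => _) = fun=> 1); first exact: trig_poly_cst.
  by apply/funext => z; rewrite big_nil.
have [pi|pi] := boolP (p i); last first.
  rewrite (_ : (fun _ => _) = fun z => \prod_(i <- r | p i) f i z)//.
  by apply/funext => z; rewrite big_cons (negbTE pi).
rewrite (_ : (fun _ => _) = fun z => f i z * \prod_(i <- r | p i) f i z).
  exact: trig_poly_mul.
by apply/funext => z; rewrite big_cons pi.
Qed.

End trigonometric_polynomials.

Section cramer_wold.
Context {R : realType} (I : finType).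
Context d (T : measurableType d) (P : probability T R).
Context d' (T' : measurableType d') (Q : probability T' R).
Variables (Z : I -> T -> R) (Z' : I -> T' -> R).
Hypotheses (mZ : forall i, measurable_fun setT (Z i)) (mZ' : forall i, measurable_fun setT (Z' i)).
Hypothesis same_projections : forall (c : I -> R) (B : set R), measurable B ->
  P ((fun w => \sum_i c i * Z i w) @^-1` B) = Q ((fun w => \sum_i c i * Z' i w) @^-1` B).

Let obs (g : (I -> R) -> R) (w : T) := g (fun i => Z i w).
Let obs' (g : (I -> R) -> R) (w : T') := g (fun i => Z' i w).

(** The bound [M] is recorded so that dominated convergence applies to sequences sharing it;
    measurability is recorded because pointwise limits inherit it. *)
Let same_mean (g : (I -> R) -> R) (M : R) : Prop :=
  [/\ measurable_fun setT (obs g), measurable_fun setT (obs' g),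
      (forall z, `|g z| <= M) &
      (\int[P]_w (obs g w)%:E = \int[Q]_w (obs' g w)%:E)%E].

Lemma bounded_integrable d0 (T0 : measurableType d0) (m : probability T0 R) (f : T0 -> R) (M : R) :
  measurable_fun setT f -> (forall w, `|f w| <= M) -> m.-integrable setT (EFin \o f).
Proof.
move=> mf fM; apply: measurable_bounded_integrable => //.
  by rewrite (le_lt_trans (@probability_le1 _ _ _ m setT measurableT)) ?ltry.
  by exists M; split; [exact: num_real|move=> x Mx w _ /=; exact: le_trans (fM w) (ltW Mx)].
Qed.

Let same_mean_trig g : trig_poly g -> exists M, same_mean g M.
Proof.
elim => [c|f h _ [M [mf mf' fM E]] _ [M' [mh mh' hM E']]|a f _ [M [mf mf' fM E]]].
- exists 1.
  have mX : measurable_fun setT (fun w => \sum_i c i * Z i w).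
    by apply: measurable_sum => i; exact: measurable_funM.
  have mX' : measurable_fun setT (fun w => \sum_i c i * Z' i w).
    by apply: measurable_sum => i; exact: measurable_funM.
  have mcos : measurable_fun setT (@cos R).
    by apply: continuous_measurable_fun; exact: continuous_cos.
  split.
  + exact: (measurableT_comp mcos).
  + exact: (measurableT_comp mcos).
  + by move=> z; exact: cos_max.
  pose X : {mfun T >-> R} := HB.pack (fun w => \sum_i c i * Z i w) (isMeasurableFun.Build _ _ _ _ _ mX).
  pose X' : {mfun T' >-> R} := HB.pack (fun w => \sum_i c i * Z' i w) (isMeasurableFun.Build _ _ _ _ _ mX').
  transitivity (\int[distribution P X]_x (cos x)%:E)%E.
    rewrite integral_distribution//; first exact/measurable_EFinP.
    apply: (@bounded_integrable _ _ _ _ 1); first exact: (measurableT_comp mcos).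
    by move=> w; exact: cos_max.
  transitivity (\int[distribution Q X']_x (cos x)%:E)%E.
    by apply: eq_measure_integral => A mA _; exact: same_projections.
  rewrite integral_distribution//; first exact/measurable_EFinP.
  apply: (@bounded_integrable _ _ _ _ 1); first exact: (measurableT_comp mcos).
  by move=> w; exact: cos_max.
- exists (M + M'); split.
  + exact: measurable_funD.
  + exact: measurable_funD.
  + by move=> z; apply: le_trans (ler_normD _ _) _; exact: lerD.
  rewrite /obs /obs'; under eq_integral do rewrite EFinD.
  under [RHS]eq_integral do rewrite EFinD.
  rewrite integralD//; last 2 first.
  + exact: (@bounded_integrable _ _ _ _ M).
  + exact: (@bounded_integrable _ _ _ _ M').
  rewrite [RHS]integralD//; last 2 first.
  + exact: (@bounded_integrable _ _ _ _ M).
  + exact: (@bounded_integrable _ _ _ _ M').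
  by congr (_ + _)%E.
- exists (`|a| * M); split.
  + exact: measurable_funM.
  + exact: measurable_funM.
  + by move=> z; rewrite normrM ler_wpM2l.
  rewrite /obs /obs'; under eq_integral do rewrite EFinM.
  under [RHS]eq_integral do rewrite EFinM.
  rewrite integralZl//; last exact: (@bounded_integrable _ _ _ _ M).
  rewrite [RHS]integralZl//; last exact: (@bounded_integrable _ _ _ _ M).
  by congr (_ * _)%E.
Qed.

Let integral_lim d0 (T0 : measurableType d0) (m : probability T0 R) (f_ : nat -> T0 -> R) (f : T0 -> R) (M : R) :
  (forall k, measurable_fun setT (f_ k)) -> (forall k w, `|f_ k w| <= M) ->
  (forall w, f_ ^~ w @ \oo --> f w) ->
  measurable_fun setT f /\
  (\int[m]_w (f_ k w)%:E)%E @[k --> \oo] --> (\int[m]_w (f w)%:E)%E.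
Proof.
move=> mf_ fM f_f.
have mf : measurable_fun setT f := measurable_fun_cvg mf_ (fun w _ => f_f w).
split => //.
have [] := @dominated_convergence _ T0 R m setT measurableT (fun k w => (f_ k w)%:E)
  (fun w => (f w)%:E) (cst M%:E).
- by move=> k; exact/measurable_EFinP.
- exact/measurable_EFinP.
- by apply: aeW => w _; apply/fine_cvgP; split; [exact: nearW|exact: f_f].
- exact: (@bounded_integrable _ _ _ (cst M) `|M|).
- by apply: aeW => w k _; rewrite lee_fin fM.
- by move=> _ _.
Qed.

Let same_mean_lim (g_ : nat -> (I -> R) -> R) (g : (I -> R) -> R) M :
  (forall k, same_mean (g_ k) M) -> (forall z, g_ ^~ z @ \oo --> g z) -> same_mean g M.
Proof.
move=> sg gg.
have sg1 k : measurable_fun setT (obs (g_ k)) by have [] := sg k.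
have sg2 k : measurable_fun setT (obs' (g_ k)) by have [] := sg k.
have sg3 k z : `|g_ k z| <= M by have [_ _ h _] := sg k.
have [mg h] := @integral_lim _ T P (fun k => obs (g_ k)) (obs g) M sg1
  (fun k w => sg3 k _) (fun w => gg _).
have [mg' h'] := @integral_lim _ T' Q (fun k => obs' (g_ k)) (obs' g) M sg2
  (fun k w => sg3 k _) (fun w => gg _).
split => //.
  move=> z.
  have cz : (fun k => `|g_ k z|) @ \oo --> `|g z| by exact: (@cvg_norm _ R^o _ _ _ _ _ (gg z)).
  rewrite -(cvg_lim (@Rhausdorff R) cz); apply: limr_le; first exact: cvgP cz.
  by apply: nearW => k; exact: sg3.
have := cvg_lim (@ereal_hausdorff R) h => <-.
have := cvg_lim (@ereal_hausdorff R) h' => <-.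
congr (lim (_ @ \oo)); apply/funext => k.
by have [_ _ _] := sg k.
Qed.

Let prod_le1 (r : seq I) (p : pred I) (f : I -> R) :
  (forall i, 0 <= f i <= 1) -> `|\prod_(i <- r | p i) f i| <= 1.
Proof.
move=> f01; rewrite normr_prod; apply: prodr_ile1 => i _.
by have /andP[f0 f1] := f01 i; rewrite ger0_norm// f0.
Qed.

Let cvg_prod_seq (r : seq I) (p : pred I) (f : I -> nat -> R) (l : I -> R) :
  (forall i, f i @ \oo --> l i) ->
  (fun k => \prod_(i <- r | p i) f i k) @ \oo --> \prod_(i <- r | p i) l i.
Proof.
move=> fl; elim: r => [|i r IH].
  under eq_fun do rewrite big_nil.
  by rewrite big_nil; exact: cvg_cst.
under eq_fun do rewrite big_cons.
by rewrite big_cons; case: (p i) => //; apply: cvgM.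
Qed.

(** The map [(1 - cos) / 2] takes values in the unit interval, so [cvg_step] writes each indicator
    as a limit of polynomials in a cosine. *)
Let same_mean_cos_box (G : {set I}) (L : R) (r : I -> R) : (forall i, 0 < r i <= 1) ->
  same_mean (fun z => \prod_(i in G) (((1 - cos (z i / L)) / 2 < r i)%R%:R)) 1.
Proof.
move=> r01.
have y01 (x : R) : 0 <= (1 - cos x) / 2 <= 1.
  by have := cos_geN1 x; have := cos_le1 x; lra.
pose f m i (z : I -> R) : R :=
  (1 - ((1 - cos (z i / L)) / 2) ^+ m) ^+ (Num.truncn (m%:R / r i ^+ m)).+1.
have tf m i : trig_poly (f m i).
  apply: trig_poly_exp.
  rewrite (_ : (fun _ => _) = fun z => 1 + -1 * ((1 - cos (z i / L)) / 2) ^+ m); last first.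
    by apply/funext => z; rewrite mulN1r.
  apply: trig_poly_add; first exact: trig_poly_cst.
  apply: trig_poly_scale; apply: trig_poly_exp.
  rewrite (_ : (fun _ => _) = fun z => 2^-1 +
      (- 2^-1) * cos (\sum_j (if j == i then L^-1 else 0) * z j)); last first.
    apply/funext => z; rewrite (bigD1 i)//= eqxx big1 => [|j /negbTE ->]; last by rewrite mul0r.
    by rewrite addr0 [L^-1 * _]mulrC; field.
  apply: trig_poly_add; first exact: trig_poly_cst.
  by apply: trig_poly_scale; exact: trig_poly_cos.
apply: (@same_mean_lim (fun m z => \prod_(i in G) f m i z)).
  (* The bound coming from the trigonometric expansion may depend on [m]; it is replaced by the
     uniform bound one, valid because every factor lies in the unit interval. *)
  move=> m; have [|M [h1 h2 _ h4]] := @same_mean_trig (fun z => \prod_(i in G) f m i z).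
    exact: trig_poly_prod.
  split => // z; apply: prod_le1 => i.
  have /andP[h h'] := y01 (z i / L).
  have a0 : 0 <= ((1 - cos (z i / L)) / 2) ^+ m by rewrite exprn_ge0.
  have a1 : ((1 - cos (z i / L)) / 2) ^+ m <= 1 by rewrite exprn_ile1.
  by apply/andP; split; [rewrite exprn_ge0//|apply: exprn_ile1]; lra.
by move=> z; apply: cvg_prod_seq => i; exact: cvg_step.
Qed.

(** The cosine boxes are periodic, but a fixed point [z] eventually lies in the central period as
    the scale [L k] grows, and there comparing cosines means comparing absolute values. *)
Let same_mean_open_box (G : {set I}) (t : I -> R) : (forall i, 0 < t i) ->
  same_mean (fun z => \prod_(i in G) ((`|z i| < t i)%R%:R)) 1.
Proof.
move=> t0.
(* [L k] exceeds every [t i] for all [k], and exceeds any given [|z i|] for large [k]. *)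
pose L k : R := k%:R + 1 + \sum_i t i.
have S0 : 0 <= \sum_i t i by apply: sumr_ge0 => i _; exact: ltW.
have L0 k : 0 < L k by rewrite /L; have := ler0n R k; lra.
have LpiL k : L k <= pi * L k.
  by rewrite ler_peMl ?(ltW (L0 k))//; have := @pi_ge2 R; lra.
have tL k i : 0 < t i < pi * L k.
  rewrite t0/=; apply: lt_le_trans (LpiL k).
  rewrite /L (bigD1 i)//=.
  have : 0 <= \sum_(j | j != i) t j by apply: sumr_ge0 => j _; exact: ltW.
  have := ler0n R k; lra.
apply: (@same_mean_lim (fun k z => \prod_(i in G)
    (((1 - cos (z i / L k)) / 2 < (1 - cos (t i / L k)) / 2)%R%:R))).
  move=> k; apply: same_mean_cos_box => i.
  have := cos_geN1 (t i / L k).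
  suff : cos (t i / L k) < 1 by lra.
  have /andP[ti tLi] := tL k i.
  rewrite -(@cos0 R) -[X in _ < cos X](mul0r (L k)^-1) ltr_cos_scaled//.
  - by rewrite normr0.
  - by rewrite normr0 (le_trans _ (ltW tLi))// ltW.
  - by rewrite ltW//= ltW.
move=> z; apply: cvg_prod_seq => i.
apply: cvg_near_cst.
near=> k.
have /andP[ti tLi] := tL k i.
rewrite -(ltr_cos_scaled (L0 k))//; last 2 first.
- apply: le_trans (LpiL k); rewrite /L.
  have : `|z i| <= k%:R by near: k; exact: nbhs_infty_ger.
  lra.
- by rewrite ltW//= ltW.
by congr (nat_of_bool _)%:R; apply/idP/idP; lra.
Unshelve. all: by end_near.
Qed.

(** Open boxes shrinking from outside; the enlargement also makes the radii positive when some [t i]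
    is zero. *)
Let same_mean_closed_box (G : {set I}) (t : I -> R) : (forall i, 0 <= t i) ->
  same_mean (fun z => \prod_(i in G) ((`|z i| <= t i)%R%:R)) 1.
Proof.
move=> t0.
apply: (@same_mean_lim (fun k z => \prod_(i in G) ((`|z i| < t i + k.+1%:R^-1)%R%:R))).
  by move=> k; apply: same_mean_open_box => i; rewrite ltr_wpDl.
move=> z; apply: cvg_prod_seq => i; apply: cvg_near_cst.
have [zt|tz] := leP `|z i| (t i).
  by apply: nearW => k; rewrite (le_lt_trans zt)// ltrDl.
have tz0 : 0 < `|z i| - t i by rewrite subr_gt0.
near=> k; rewrite ltNge (_ : t i + _ <= _)//.
have : k.+1%:R^-1 < `|z i| - t i by near: k; exact: (near_infty_natSinv_lt (PosNum tz0)).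
by move=> /ltW; rewrite lerBrDl.
Unshelve. all: by end_near.
Qed.

Lemma cramer_wold_box (G : {set I}) (t : I -> R) :
  P [set w | forall i, i \in G -> `|Z i w| <= t i] =
  Q [set w | forall i, i \in G -> `|Z' i w| <= t i].
Proof.
(* A negative bound at an index of [G] makes both events empty. Otherwise [Num.max (t i) 0] equals
   [t i] on [G] and is non-negative off [G]. *)
have [[i [iG ti]]|nt] := pselect (exists i, i \in G /\ t i < 0).
  rewrite (_ : [set w | _] = set0) ?measure0; last first.
    by apply/seteqP; split => // w /(_ _ iG) /(le_trans (normr_ge0 _)); rewrite leNgt ti.
  rewrite (_ : [set w | _] = set0) ?measure0//.
  by apply/seteqP; split => // w /(_ _ iG) /(le_trans (normr_ge0 _)); rewrite leNgt ti.
have E (z : I -> R) : \prod_(i in G) ((`|z i| <= Num.max (t i) 0)%R%:R) =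
    (`[< forall i, i \in G -> `|z i| <= t i >])%:R :> R.
  have tm i : i \in G -> Num.max (t i) 0 = t i.
    move=> iG; apply/max_idPl; rewrite leNgt; apply/negP => ti; apply: nt; by exists i.
  case: asboolP => h; first by rewrite big1// => i iG; rewrite tm// h.
  have [i iG hi] : exists2 i, i \in G & ~~ (`|z i| <= t i).
    apply: contrapT => H; apply: h => i iG; apply: contrapT => /negP hi.
    by apply: H; exists i.
  by rewrite (bigD1 i)//= tm// (negbTE hi) mul0r.
have t0 i : 0 <= Num.max (t i) 0 by rewrite le_max lexx orbT.
have [_ _ _ h4] := @same_mean_closed_box G (fun i => Num.max (t i) 0) t0.
have mbox d0 (T0 : measurableType d0) (Y : I -> T0 -> R) : (forall i, measurable_fun setT (Y i)) ->
    measurable [set w | forall i, i \in G -> `|Y i w| <= t i].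
  move=> mY.
  rewrite (_ : mkset _ = \bigcap_(i in [set` G]) [set w | `|Y i w| <= t i]).
    apply: fin_bigcap_measurable => // i _.
    by apply: (measurable_ler_set (g := cst (t i))) => //; exact: measurableT_comp.
  by apply/seteqP; split => w h i /h.
rewrite probability_integral_indic; last exact: mbox.
rewrite [RHS]probability_integral_indic; last exact: mbox.
have ind d0 (T0 : measurableType d0) (Y : I -> T0 -> R) w :
    \1_[set w | forall i, i \in G -> `|Y i w| <= t i] w =
    \prod_(i in G) ((`|Y i w| <= Num.max (t i) 0)%R%:R) :> R.
  by rewrite E indicE.
under eq_integral do rewrite ind.
by under [RHS]eq_integral do rewrite ind.
Qed.

End cramer_wold.

(** * Spectral gap of a symmetric matrix *)

Section symmetric_spectrum.
Context {R : realType}.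
Local Notation C := (complex R).
Local Notation toC := (real_complex R).

Lemma unitary_sqnorm n (U : 'M[C]_n) (v : 'cV[C]_n) : U \is unitarymx ->
  \sum_i `|(U *m v) i 0| ^+ 2 = \sum_i `|v i 0| ^+ 2.
Proof.
have sqE (x : 'cV[C]_n) : \sum_i `|x i 0| ^+ 2 = ((map_mx Num.conj x)^T *m x) 0 0.
  by rewrite mxE; apply: eq_bigr => i _; rewrite !mxE normCK mulrC.
move=> /unitarymxP/mulmx1C UU; rewrite !sqE map_mxM trmx_mul.
by rewrite mulmxA -[_ *m _ *m U]mulmxA [(map_mx _ U)^T]map_trmx UU mulmx1.
Qed.

Lemma norm_toC (x : R) : `|toC x| ^+ 2 = toC (x ^+ 2).
Proof. by rewrite normc_def/= expr0n/= addr0 sqrtr_sqr -rmorphXn/= real_normK// num_real. Qed.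

Variables (n : nat) (S : 'M[R]_n).
Hypothesis S_sym : S^T = S.

(** The spectral theorem is applied to the complexification of [S], which is hermitian; its diagonal
    entries turn out real and are exactly the eigenvalues of [S]. *)
Let SC : 'M[C]_n := map_mx toC S.
Let U := spectralmx SC.
Let D := spectral_diag SC.

Let SC_herm : SC \is hermsymmx.
Proof.
apply: realsym_hermsym.
  apply/is_hermitianmxP; rewrite expr0 scale1r map_mx_id//.
  by rewrite /SC map_trmx S_sym.
apply/mxOverP => i j; rewrite mxE; apply/CrealP.
exact: conjc_real.
Qed.

Let SCE : SC = (U ^t*)%sesqui *m diag_mx D *m U.
Proof.
rewrite -invmx_unitary ?spectral_unitarymx//.
exact/orthomx_spectralP/hermitian_normalmx.
Qed.

Let U_unitary : U \is unitarymx. Proof. exact: spectral_unitarymx. Qed.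

Let D_real i : D 0 i = toC (complex.Re (D 0 i)).
Proof.
have /mxOverP/(_ 0 i)/CrealP := hermitian_spectral_diag_real SC_herm.
rewrite -/D; case: (D 0 i) => x y /= [yy].
by congr (_ +i* _)%C; lra.
Qed.

Let U_SC v i : (U *m (SC *m v : 'cV[C]_n)) i 0 = D 0 i * (U *m v) i 0.
Proof.
rewrite {1}SCE -!mulmxA (mulmxA U) (unitarymxP U_unitary) mul1mx.
by rewrite mul_diag_mx mxE.
Qed.

Let D_eigenvalue i : eigenvalue S (complex.Re (D 0 i)).
Proof.
rewrite -(eigenvalue_map toC) [X in eigenvalue _ X](_ : _ = D 0 i); last exact/esym/D_real.
apply/eigenvalueP; exists (row i U).
  rewrite -row_mul -/SC {1}SCE -!mulmxA (mulmxA U) (unitarymxP U_unitary) mul1mx.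
  by apply/rowP => j; rewrite mxE mul_diag_mx !mxE.
apply/negP => /eqP Ui.
have := row_mul i U (U ^t*)%sesqui; rewrite (unitarymxP U_unitary) Ui mul0mx.
by move/rowP/(_ i); rewrite !mxE eqxx => /eqP; rewrite oner_eq0.
Qed.

Let eigenvalue_D a : eigenvalue S a -> exists i, a = complex.Re (D 0 i).
Proof.
rewrite -(eigenvalue_map toC) => /eigenvalueP[v vS v0].
pose b := v *m (U ^t*)%sesqui.
have vE : v = b *m U.
  by rewrite /b -mulmxA; have /mulmx1C -> := unitarymxP U_unitary; rewrite mulmx1.
have b0 : b != 0 by apply: contra v0 => /eqP b0; rewrite vE b0 mul0mx.
have /rV0Pn[i bi] := b0.
have : b *m diag_mx D = toC a *: b.
  by rewrite /b scalemxAl -vS -/SC {1}SCE !mulmxA mulmxtVK.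
move/rowP/(_ i); rewrite mul_mx_diag mxE [RHS]mxE => /eqP.
rewrite mulrC -subr_eq0 -mulrBl mulf_eq0 (negbTE bi) orbF subr_eq0 => /eqP E.
by exists i; rewrite E.
Qed.

(** In an eigenbasis a coordinate of [S *m y] is zero when its eigenvalue is zero, and is otherwise
    stretched by at least [mu] under a further application of [S]. *)
Lemma symmetric_gap (mu : R) (y : 'cV[R]_n) : 0 <= mu ->
  (forall a, eigenvalue S a -> a != 0 -> mu <= `|a|) ->
  mu ^+ 2 * \sum_i (S *m y) i 0 ^+ 2 <= \sum_i (S *m (S *m y)) i 0 ^+ 2.
Proof.
move=> mu0 gap.
rewrite -lecR rmorphM/= !rmorph_sum/=.
have sq (v : 'cV[R]_n) : \sum_i toC (v i 0 ^+ 2) = \sum_i `|(U *m map_mx toC v) i 0| ^+ 2.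
  by rewrite (unitary_sqnorm _ U_unitary); apply: eq_bigr => i _; rewrite mxE norm_toC.
rewrite !sq !map_mxM -/SC mulr_sumr; apply: ler_sum => i _.
rewrite !U_SC !normrM !exprMn; set x := `|(U *m _) i 0| ^+ 2.
have x0 : 0 <= x by rewrite exprn_ge0.
have [Di|Di] := eqVneq (complex.Re (D 0 i)) 0.
  by rewrite D_real Di normr0 expr0n/= !mul0r mulr0.
rewrite ler_wpM2r ?mulr_ge0 ?exprn_ge0//.
rewrite D_real norm_toC lecR -[leRHS]real_normK ?num_real//.
by rewrite ler_pXn2r ?nnegrE// gap.
Qed.

(** There are finitely many eigenvalues; the minimum starts from the default [1], so it stays
    positive even if all of them vanish. *)
Lemma nonzero_eigenvalue_lower_bound :
  exists2 c : R, 0 < c & forall a, eigenvalue S a -> a != 0 -> c <= `|a|.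
Proof.
exists (\big[Num.min/1]_(i | complex.Re (D 0 i) != 0) `|complex.Re (D 0 i)|).
  by apply: lt_bigmin => // i Di; rewrite normr_gt0.
by move=> a /eigenvalue_D[i ->] Di; apply: bigmin_le_cond.
Qed.

End symmetric_spectrum.

(** * Algebra of the ridge estimator *)

Section gram.
Context {R : realType}.

Lemma mulmx_trE m n (A : 'M[R]_(m, n)) i : (A *m A^T) i i = \sum_j A i j ^+ 2.
Proof. by rewrite mxE; apply: eq_bigr => j _; rewrite mxE. Qed.

Lemma mulmx_tr_ge0 m n (A : 'M[R]_(m, n)) i : 0 <= (A *m A^T) i i.
Proof. by rewrite mulmx_trE; apply: sumr_ge0 => j _; exact: sqr_ge0. Qed.

Lemma mulmx_tr_eq0 m n (A : 'M[R]_(m, n)) : A *m A^T = 0 -> A = 0.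
Proof.
move=> A0; apply/matrixP => i j; rewrite mxE.
have : (A *m A^T) i i = 0 by rewrite A0 mxE.
rewrite mulmx_trE => /eqP; rewrite psumr_eq0 => [/allP/(_ j)|k _]; last exact: sqr_ge0.
by rewrite mem_index_enum => /(_ isT); rewrite sqrf_eq0 => /eqP.
Qed.

End gram.

Section ridge_algebra.
Context {R : realType} (N p : nat) (X : 'M[R]_(N, p)) (G : 'M[R]_N) (lam : R).
Hypotheses (N0 : (0 < N)%N) (hG : is_MP_pinv (X *m X^T) G) (lam0 : 0 < lam).

Let S := Sigma_hat X.
Let K := S + lam%:M.

Lemma Sigma_hat_sym : S^T = S.
Proof. by rewrite /S /Sigma_hat linearZ/= trmx_mul trmxK. Qed.

Let K_sym : K^T = K.
Proof. by rewrite /K linearD/= Sigma_hat_sym tr_scalar_mx. Qed.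

Let row_quad (v : 'rV[R]_p) :
  (v *m S *m v^T) 0 0 = N%:R^-1 * ((v *m X^T) *m (v *m X^T)^T) 0 0.
Proof.
rewrite /S /Sigma_hat -scalemxAr -scalemxAl mxE; congr (_ * _).
by rewrite trmx_mul trmxK !mulmxA.
Qed.

Let Sigma_hat_psd (v : 'rV[R]_p) : 0 <= (v *m S *m v^T) 0 0.
Proof. by rewrite row_quad mulr_ge0// mulmx_tr_ge0. Qed.

Lemma ridge_mx_unit : K \in unitmx.
Proof.
rewrite -row_free_unit; apply: inj_row_free => v vK.
apply: mulmx_tr_eq0; apply/matrixP => i j; rewrite !ord1 [RHS]mxE.
have : (v *m K *m v^T) 0 0 = 0 by rewrite vK mul0mx mxE.
rewrite /K mulmxDr mulmxDl mxE mul_mx_scalar -scalemxAl [X in _ + X]mxE.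
have := Sigma_hat_psd v; have := mulmx_tr_ge0 v 0; have := lam0; nra.
Qed.

Let A := X *m X^T.

(** The difference is [(A G - 1) X], and its Gram matrix contains the factor [(A G - 1) A], which is
    zero. *)
Let pinv_fix : A *m G *m X = X.
Proof.
have [h1 _ h3 _] := hG.
apply/eqP; rewrite -subr_eq0; apply/eqP; apply: mulmx_tr_eq0.
rewrite -[X in _ - X]mul1mx -mulmxBl trmx_mul mulmxA -[_ *m X *m X^T]mulmxA -/A.
by rewrite mulmxBl mul1mx h1 subrr mul0mx.
Qed.

Let pinv_fix_tr : X^T *m A *m G = X^T.
Proof.
have [_ _ h3 _] := hG.
by rewrite -mulmxA -[in RHS]pinv_fix trmx_mul h3.
Qed.

Lemma Sigma_hat_PX : S *m PX X G = S.
Proof.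
rewrite /S /Sigma_hat -scalemxAl; congr (_ *: _).
rewrite -mulmxA; congr (_ *m _).
by rewrite /PX !mulmxA -/A pinv_fix.
Qed.

Lemma PX_range (b : 'cV[R]_p) : exists y, PX X G *m b = S *m y.
Proof.
(* Replacing [X^T] by [X^T A G] in [X^T G X b] exposes a leading [X^T X]; the factor [N] cancels the
   normalisation of [Sigma_hat]. *)
exists (N%:R *: (X^T *m G *m G *m X *m b)).
rewrite /S /Sigma_hat -scalemxAr -scalemxAl scalerA mulfV ?pnatr_eq0 -?lt0n// scale1r.
rewrite /PX -[in LHS]pinv_fix_tr.
by rewrite /A !mulmxA.
Qed.

Definition ridge_noise_mx : 'M[R]_(p, N) := N%:R^-1 *: (invmx K *m X^T).

(** [Sigma_hat] does not see the part of [b] outside the row space, so [b] may be projected to [t];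
    then [S t = K t - lam t] splits the signal from the bias. *)
Lemma ridge_decomposition (b : 'cV[R]_p) (e : 'cV[R]_N) :
  ridge X lam (X *m b + e) =
  PX X G *m b - lam *: (invmx K *m (PX X G *m b)) + ridge_noise_mx *m e.
Proof.
rewrite /ridge -/S -/K mulmxDr scalerDr mulmxDr; congr (_ + _); last first.
  by rewrite /ridge_noise_mx -scalemxAr -scalemxAl mulmxA.
rewrite mulmxA scalemxAl -/(Sigma_hat X) -/S -[in LHS]Sigma_hat_PX -mulmxA.
set t := PX X G *m b.
have -> : S *m t = K *m t - lam *: t by rewrite /K mulmxDl mul_scalar_mx addrK.
by rewrite mulmxBr (mulKmx ridge_mx_unit) -scalemxAr.
Qed.

Lemma Omega_ridge_noise :
  Omega_mx S lam = N%:R *: (ridge_noise_mx *m ridge_noise_mx^T).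
Proof.
have Kt : (invmx K)^T = invmx K by rewrite trmx_inv K_sym.
have Bt : ridge_noise_mx^T = N%:R^-1 *: (X *m invmx K).
  by rewrite /ridge_noise_mx linearZ/= trmx_mul trmxK Kt.
rewrite Bt /Omega_mx -/K /ridge_noise_mx.
rewrite -scalemxAl -scalemxAr scalerA mulfV ?pnatr_eq0 -?lt0n// scale1r.
by rewrite /S /Sigma_hat -scalemxAr -scalemxAl !mulmxA.
Qed.

Let eigenvalue_ge0 a : eigenvalue S a -> 0 <= a.
Proof.
move=> /eigenvalueP[v vS v0]; have := Sigma_hat_psd v.
rewrite vS -scalemxAl mxE => h.
have vv : 0 < (v *m v^T) 0 0.
  rewrite lt_neqAle mulmx_tr_ge0 andbT eq_sym; apply: contra v0 => /eqP v0.
  apply/eqP/mulmx_tr_eq0/matrixP => i j; rewrite !ord1 v0 mxE//.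
by rewrite -(pmulr_lge0 _ vv).
Qed.

(** The vector [w], the image of [t] under the inverse of [K], lies in the range of [S], so the
    spectral gap gives [mu |w| <= |S w|]. Moreover [t = S w + lam w] with [S] positive semidefinite,
    whence [|S w| <= |t|]. *)
Lemma ridge_bias_bound (b : 'cV[R]_p) (j : 'I_p) :
  `|(lam *: (invmx K *m (PX X G *m b))) j 0| <=
  lam * norm2 (PX X G *m b) * (lambda_min_nz S)^-1.
Proof.
have [y yE] := PX_range b.
set t := PX X G *m b in yE *.
pose w := invmx K *m t.
pose sq (v : 'cV[R]_p) := \sum_i v i 0 ^+ 2.
have sq0 v : 0 <= sq v by apply: sumr_ge0 => i _; exact: sqr_ge0.
have wE : w = S *m (invmx K *m y).
  have KS : S *m K = K *m S by rewrite /K mulmxDl mulmxDr scalar_mxC.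
  rewrite /w yE mulmxA [RHS]mulmxA; congr (_ *m _).
  apply: (canLR (mulKmx ridge_mx_unit)).
  by rewrite mulmxA -KS -mulmxA mulmxV ?ridge_mx_unit// mulmx1.
have Kw : t = S *m w + lam *: w.
  by rewrite -mul_scalar_mx -mulmxDl mulKVmx// ridge_mx_unit.
have Sw_t : sq (S *m w) <= sq t.
  have : sq t = sq (S *m w) + 2 * lam * (w^T *m S *m w^T^T) 0 0 + lam ^+ 2 * sq w.
    rewrite Kw /sq.
    rewrite trmxK -mulmxA mxE !mulr_sumr -!big_split/=; apply: eq_bigr => i _.
    by rewrite !mxE; ring.
  have := Sigma_hat_psd w^T; have := sq0 w; have := sqr_ge0 lam.
  move: lam0 (sq0 (S *m w)); nra.
have [c c0 gap] := nonzero_eigenvalue_lower_bound Sigma_hat_sym.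
pose E := [set a : R | eigenvalue S a /\ a != 0].
have Elb : has_lbound E.
  by exists 0 => a [/eigenvalue_ge0].
pose mu := lambda_min_nz S.
have gap_mu a : eigenvalue S a -> a != 0 -> mu <= `|a|.
  move=> ea a0; rewrite ger0_norm ?eigenvalue_ge0//; apply: ge_inf => //.
have coord_le (v : 'cV[R]_p) i : `|v i 0| <= norm2 v.
  rewrite -sqrtr_sqr ler_wsqrtr// (bigD1 i)//= lerDl.
  by apply: sumr_ge0 => k _; exact: sqr_ge0.
have [E0|/set0P E0] := eqVneq E set0; last first.
  have mu0 : 0 < mu.
    apply: lt_le_trans c0 _; apply: lb_le_inf => // a [ea a0].
    by rewrite -(ger0_norm (eigenvalue_ge0 ea)) gap.
  rewrite mxE normrM gtr0_norm// -mulrA ler_pM2l// -/w.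
  apply: le_trans (coord_le w j) _.
  rewrite ler_pdivlMr// mulrC /norm2.
  rewrite -[X in X * _](gtr0_norm mu0) -sqrtr_sqr -sqrtrM ?sqr_ge0//.
  rewrite ler_wsqrtr//; apply: le_trans Sw_t; rewrite /sq wE.
  by apply: symmetric_gap => //; [exact: Sigma_hat_sym|exact: ltW].
(* Without nonzero eigenvalues [lambda_min_nz] is the infimum of the empty set, which is [0] with
   inverse [0], so the bias itself must vanish. The gap hypothesis is then vacuous, and a [mu] whose
   square is [sq t / sq w + 1] contradicts [w != 0]. *)
have w0 : sq w <= 0.
  rewrite leNgt; apply/negP => w0.
  have M0 : 0 <= sq t / sq w + 1 by rewrite addr_ge0// divr_ge0.
  have : Num.sqrt (sq t / sq w + 1) ^+ 2 * sq w <= sq t.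
    apply: le_trans Sw_t; rewrite /sq wE.
    apply: symmetric_gap; [exact: Sigma_hat_sym|exact: sqrtr_ge0|] => a ea a0.
    by have : E a; [|rewrite E0].
  by rewrite sqr_sqrtr// mulrDl mul1r divfK ?gt_eqF// gerDl leNgt w0.
rewrite /lambda_min_nz -/E E0 inf0 invr0 mulr0 mxE normrM -/w.
suff -> : `|w j 0| = 0 by rewrite mulr0.
apply/eqP; rewrite eq_le normr_ge0 andbT; apply: le_trans (coord_le w j) _.
by rewrite /norm2 -/(sq w) ler0_sqrtr.
Qed.

End ridge_algebra.

(** * The corrected ridge estimator at a fixed sample size *)

(** The complement of the event is a box with sides [(u - D j) / a j], to which [cramer_wold_box]
    applies. *)
Lemma gaussian_vector_box {R : realType} (p : nat) (C : 'M[R]_p)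
  d (T : measurableType d) (P : probability T R) (Z : 'I_p -> T -> R)
  d' (T' : measurableType d') (Q : probability T' R) (Z' : 'I_p -> T' -> R)
  (G : {set 'I_p}) (a D : 'I_p -> R) (u : R) : (forall j, 0 < a j) ->
  gaussian_vector P Z C -> gaussian_vector Q Z' C ->
  P [set w | exists2 j, j \in G & u < a j * `|Z j w| + D j] =
  Q [set w | exists2 j, j \in G & u < a j * `|Z' j w| + D j].
Proof.
move=> a0 [mZ PZ] [mZ' QZ'].
have E d0 (T0 : measurableType d0) (Y : 'I_p -> T0 -> R) :
    [set w | exists2 j, j \in G & u < a j * `|Y j w| + D j] =
    ~` [set w | forall j, j \in G -> `|Y j w| <= (u - D j) / a j].
  apply/seteqP; split => w /=.
    move=> [j jG h] H; have := H j jG; rewrite ler_pdivlMr// => h'.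
    by move: h; rewrite ltNge => /negP; apply; lra.
  move=> H; apply: contrapT => H2; apply: H => j jG.
  rewrite ler_pdivlMr// leNgt; apply/negP => h; apply: H2; exists j => //; lra.
have mbox d0 (T0 : measurableType d0) (Y : 'I_p -> T0 -> R) : (forall i, measurable_fun setT (Y i)) ->
    measurable [set w | forall j, j \in G -> `|Y j w| <= (u - D j) / a j].
  move=> mY.
  rewrite (_ : mkset _ = \bigcap_(j in [set` G]) [set w | `|Y j w| <= (u - D j) / a j]).
    apply: fin_bigcap_measurable => // j _.
    by apply: (measurable_ler_set (g := cst _)) => //; exact: measurableT_comp.
  by apply/seteqP; split => w h i /h.
rewrite !E !probability_setC; [|exact: mbox|exact: mbox].
congr (1 - _)%E; apply: cramer_wold_box => // c B mB.
by rewrite PZ// QZ'.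
Qed.

Section ridge_sample.
Context {R : realType} d (T : measurableType d) (P : probability T R).
Variables (N p : nat) (X : 'M[R]_(N, p)) (Ginv : 'M[R]_N) (beta0 : 'cV[R]_p).
Variables (sigma lam : R) (e : 'I_N -> T -> R).
Hypotheses (N0 : (0 < N)%N) (hGinv : is_MP_pinv (X *m X^T) Ginv).
Hypotheses (sigma0 : 0 < sigma) (lam0 : 0 < lam).
Hypothesis me : forall i, measurable_fun setT (e i).
Hypothesis law_e : forall i B, measurable B -> P (e i @^-1` B) = normal_prob 0 sigma B.
Hypothesis ie : mutually_independent P e.

Let O := Omega_mx (Sigma_hat X) lam.
Let B := ridge_noise_mx X lam.
Let PXm := PX X Ginv.
Let a j := a_coef N sigma O j.
Let theta := PXm *m beta0.

Hypothesis Omin0 : 0 < Omega_min O.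

Let OE j : O j j = N%:R * \sum_i B j i ^+ 2.
Proof. by rewrite /O Omega_ridge_noise// mxE mulmx_trE. Qed.

Let Omin_le j : Omega_min O <= O j j.
Proof.
apply: ge_inf; last by exists j.
exists 0 => _ [k _ <-]; rewrite OE mulr_ge0//.
by apply: sumr_ge0 => i _; exact: sqr_ge0.
Qed.

Let O_gt0 j : 0 < O j j. Proof. exact: lt_le_trans (Omin_le j). Qed.

Lemma a_coef_gt0 j : 0 < a j.
Proof. by rewrite /a /a_coef !mulr_gt0 ?invr_gt0 ?sqrtr_gt0 ?ltr0n. Qed.

Lemma a_coef_unit_variance j : \sum_i (a j * B j i) ^+ 2 * sigma ^+ 2 = 1.
Proof.
rewrite -mulr_suml.
under eq_bigr do rewrite exprMn.
rewrite -mulr_sumr.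
have S2 : \sum_i B j i ^+ 2 = O j j / N%:R.
  by rewrite OE mulrAC mulfV ?mul1r// pnatr_eq0 -lt0n.
rewrite S2 /a /a_coef !exprMn !exprVn !sqr_sqrtr ?ler0n ?ltW//.
have Nn : N%:R != 0 :> R by rewrite pnatr_eq0 -lt0n.
by field; rewrite Nn !gt_eqF.
Qed.

(** Bounding the diagonal entry of [O] below by [Omega_min O] gives a bound uniform in [j], namely
    the expression of the rate hypothesis up to [sigma^-1]. *)
Lemma a_coef_bias j :
  a j * `|(lam *: (invmx (Sigma_hat X + lam%:M) *m theta)) j 0| <=
  sigma^-1 * (Num.sqrt N%:R * norm2 theta * lam * (Num.sqrt (Omega_min O))^-1
    * (lambda_min_nz (Sigma_hat X))^-1).
Proof.
have h := ridge_bias_bound N0 hGinv lam0 beta0 j.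
apply: le_trans (ler_wpM2l (ltW (a_coef_gt0 j)) h) _.
rewrite /a /a_coef -/PXm -/theta.
set l := (lambda_min_nz _)^-1.
have r0 : 0 <= lam * norm2 theta * l by apply: le_trans h.
rewrite [leRHS](_ : _ = Num.sqrt N%:R * sigma^-1 * (Num.sqrt (Omega_min O))^-1
  * (lam * norm2 theta * l)); last by ring.
have s0 : 0 <= Num.sqrt N%:R * sigma^-1 by rewrite mulr_ge0 ?sqrtr_ge0// invr_ge0 ltW.
rewrite ler_wpM2r// ler_wpM2l//.
by rewrite lef_pV2 ?posrE ?sqrtr_gt0// ler_wsqrtr.
Qed.

Lemma ridge_noise_anticoncentration (G : {set 'I_p}) (D : 'I_p -> R) (u del : R) (m : nat) :
  (forall j, 0 <= D j) -> 0 <= u -> 0 <= del -> (0 < m)%N -> m%:R * del <= 1 ->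
  fine (P [set w | exists2 j, j \in G & u - del < a j * `|\sum_i B j i * e i w| + D j]) <=
  fine (P [set w | exists2 j, j \in G & u < a j * `|\sum_i B j i * e i w| + D j])
  + expR (u + 1) / m%:R.
Proof.
move=> D0 u0 del0 m0 mdel.
(* [|Z_j|] is the larger of [Z_j] and [- Z_j]; indexing by a sign as well turns the maximum over [G]
   into one of linear forms, all of unit variance. *)
pose K : finType := ({j : 'I_p | j \in G} * bool)%type.
pose sg (b : bool) : R := (-1) ^+ b.
pose c (k : 'I_#|K|) i := sg (enum_val k).2 * (a (val (enum_val k).1) * B (val (enum_val k).1) i).
pose D' (k : 'I_#|K|) := D (val (enum_val k).1).
have := @gaussian_max_anticoncentration R d T P sigma N e sigma0 me law_e ie #|K| c D' _ _ u del m u0 del0 m0 mdel.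
have E x : [set w | exists k, x < \sum_(i < N) c k i * e i w + D' k] =
    [set w | exists2 j, j \in G & x < a j * `|\sum_i B j i * e i w| + D j].
  have cE k w : \sum_(i < N) c k i * e i w =
      sg (enum_val k).2 * (a (val (enum_val k).1) * \sum_i B (val (enum_val k).1) i * e i w).
    rewrite !mulr_sumr; apply: eq_bigr => i _; rewrite /c; ring.
  apply/seteqP; split => w /=.
    move=> [k]; rewrite cE => h; exists (val (enum_val k).1); first exact: (valP (enum_val k).1).
    apply: lt_le_trans h _; rewrite /D' lerD2r.
    rewrite -[X in X * `|_|](gtr0_norm (a_coef_gt0 _)) -normrM.
    apply: le_trans (ler_norm _) _.
    by rewrite [leLHS]normrM /sg/= normr_sign mul1r.
  move=> [j jG h].
  pose b := \sum_i B j i * e i w < 0.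
  exists (enum_rank (exist _ j jG, b)); rewrite cE /D' enum_rankK/=.
  apply: lt_le_trans h _; rewrite lerD2r mulrCA ler_pM2l ?a_coef_gt0//.
  rewrite /sg /b; case: ltP => h'; first by rewrite expr1 mulN1r ltr0_norm.
  by rewrite expr0 mul1r ger0_norm.
rewrite !E; apply.
- move=> k; rewrite -(a_coef_unit_variance (val (enum_val k).1)).
  by apply: eq_bigr => i _; rewrite /c exprMn /sg sqrr_sign mul1r.
- by move=> k; exact: D0.
Qed.

Section corrected.
Variables (binit : T -> 'cV[R]_p) (D : 'I_p -> R) (G : {set 'I_p}).
Hypothesis mbinit : forall k, measurable_fun setT (fun w => binit w k 0).
Hypothesis D0 : forall j, 0 < D j.

Let Y w : 'cV[R]_N := X *m beta0 + \col_i e i w.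
Let Z j w := \sum_i B j i * e i w.
Let bias j := (lam *: (invmx (Sigma_hat X + lam%:M) *m theta)) j 0.
Let bcorr w j := ridge_corr PXm (ridge X lam (Y w)) (binit w) j.
Let remainder j w := a j * \sum_(k < p | k != j) PXm j k * (binit w k 0 - beta0 k 0).

Let bcorrE w j :
  bcorr w j = theta j 0 - bias j + Z j w - \sum_(k < p | k != j) PXm j k * binit w k 0.
Proof.
rewrite /bcorr /ridge_corr /Y (ridge_decomposition hGinv lam0); congr (_ - _).
rewrite mxE [X in X + _]mxE [X in _ + X + _]mxE; congr (_ + _).
by rewrite mxE; apply: eq_bigr => i _; rewrite [X in _ * X]mxE.
Qed.

(** When [beta0_j = 0], [theta_j] is the sum over [k != j] of [PXm j k * beta0_k], which combines
    with the correction term into the error of [binit]. *)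
Let bcorr_null w j : beta0 j 0 = 0 ->
  a j * bcorr w j = a j * Z j w - a j * bias j - remainder j w.
Proof.
move=> bj; rewrite bcorrE /theta mxE (bigD1 j)//= bj mulr0 add0r /remainder.
under [X in _ = _ - _ * X]eq_bigr do rewrite mulrBr.
by rewrite sumrB; ring.
Qed.

Let measurable_Z j : measurable_fun setT (Z j).
Proof. by apply: measurable_sum => i; exact: measurable_funM. Qed.

Let measurable_off_diagonal (f : 'I_p -> T -> R) j : (forall k, measurable_fun setT (f k)) ->
  measurable_fun setT (fun w => \sum_(k < p | k != j) PXm j k * f k w).
Proof.
move=> mf; under eq_fun do rewrite big_mkcond.
apply: measurable_sum => k; case: (k != j) => //.
exact: measurable_funM.
Qed.

Let measurable_bcorr j : measurable_fun setT (bcorr ^~ j).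
Proof.
under eq_fun do rewrite bcorrE.
apply: measurable_funB.
  by apply: measurable_funD => //; exact: measurable_Z.
exact: (measurable_off_diagonal (f := fun k w => binit w k 0)).
Qed.

Let measurable_exists (F : 'I_p -> T -> R) x : (forall j, measurable_fun setT (F j)) ->
  measurable [set w | exists2 j, j \in G & x < F j w].
Proof.
move=> mF; rewrite (_ : mkset _ = \bigcup_(j in [set` G]) [set w | x < F j w]).
  apply: fin_bigcup_measurable => // j _.
  exact: (measurable_ltr_set (f := cst x)).
by apply/seteqP; split => w [j jG h]; exists j.
Qed.

(** On the good event the triangle inequality replaces the estimator by [|Z_j|] plus [D j] at the
    cost [del] in the level; anticoncentration restores the level [u], and a union bound accounts
    for the complement of the good event. *)
Lemma corrected_ridge_tail (u del : R) (m : nat) :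
  (forall j, j \in G -> beta0 j 0 = 0) ->
  0 <= u -> 0 <= del -> (0 < m)%N -> m%:R * del <= 1 ->
  (forall j, a j * `|bias j| <= del) ->
  (P [set w | exists2 j, j \in G & (u < a j * `|bcorr w j|)%R] <=
   P [set w | exists2 j, j \in G & (u < a j * `|Z j w| + D j)%R] +
   (expR (u + 1) / m%:R + (1 - fine (P [set w | forall j, (`|remainder j w| <= D j)%R])))%:E)%E.
Proof.
move=> nullG u0 del0 m0 mdel hbias.
have mrem j : measurable_fun setT (remainder j).
  apply: measurable_funM => //.
  apply: (measurable_off_diagonal (f := fun k w => binit w k 0 - beta0 k 0)) => k.
  exact: measurable_funB.
set good := [set w | forall j, _].
have mgood : measurable good.
  rewrite (_ : good = \bigcap_(j in [set: 'I_p]) [set w | `|remainder j w| <= D j]).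
    apply: fin_bigcap_measurable => // j _.
    by apply: (measurable_ler_set (g := cst _)) => //; exact: measurableT_comp.
  by apply/seteqP; split => [w h j _|w h j]; [exact: h|exact: (h j I)].
have mA : measurable [set w | exists2 j, j \in G & u < a j * `|bcorr w j|].
  apply: (measurable_exists (F := fun j w => a j * `|bcorr w j|)) => j.
  by apply: measurable_funM => //; exact: measurableT_comp.
have mB x : measurable [set w | exists2 j, j \in G & x < a j * `|Z j w| + D j].
  apply: (measurable_exists (F := fun j w => a j * `|Z j w| + D j)) => j.
  by apply: measurable_funD => //; apply: measurable_funM => //; exact: measurableT_comp.
have sub : [set w | exists2 j, j \in G & u < a j * `|bcorr w j|] `<=`
    [set w | exists2 j, j \in G & u - del < a j * `|Z j w| + D j] `|` ~` good.
  move=> w [j jG h].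
  have [gw|] := pselect (good w); last by right.
  left; exists j => //; rewrite ltrBlDr; apply: lt_le_trans h _.
  have aj : `|a j| = a j by rewrite gtr0_norm// a_coef_gt0.
  rewrite -[X in X * `|bcorr w j|]aj -normrM bcorr_null ?nullG//.
  apply: le_trans (ler_normB _ _) _; apply: le_trans (lerD (ler_normB _ _) (gw j)) _.
  rewrite [`|a j * Z j w|]normrM [`|a j * bias j|]normrM aj.
  have := hbias j; lra.
have := ridge_noise_anticoncentration G (fun j => ltW (D0 j)) u0 del0 m0 mdel.
rewrite -/(Z _ _) => anti.
have fin (A : set T) : measurable A -> (fine (P A))%:E = P A.
  by move=> mA'; rewrite fineK// fin_num_measure.
have : fine (P [set w | exists2 j, j \in G & u < a j * `|bcorr w j|]) <=
    fine (P [set w | exists2 j, j \in G & u - del < a j * `|Z j w| + D j]) +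
    (1 - fine (P good)).
  rewrite -lee_fin EFinD EFinB !fin// -probability_setC//.
  apply: le_trans (measureU2 _ _ _) => //; last exact: measurableC.
  apply: le_measure => //; rewrite inE//.
  by apply: measurableU => //; exact: measurableC.
rewrite -[X in (X <= _)%E]fin// -[X in (_ <= X + _)%E]fin// -EFinD lee_fin.
rewrite -/(Z _ _) in anti *; lra.
Qed.

End corrected.

End ridge_sample.

(** * Passage to the limit *)

Lemma limn_esup_le0 {R : realType} (x : nat -> \bar R) :
  (forall r : R, 0 < r -> \forall n \near \oo, (x n <= r%:E)%E) ->
  (limn_esup x <= 0)%E.
Proof.
move=> H; apply/lee_addgt0Pr => r r0; rewrite add0e.
apply: ge_ereal_inf; exists (ereal_sup (x @` [set n | (x n <= r%:E)%E])).
  by exists [set n | (x n <= r%:E)%E] => //; exact: H.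
by apply: ub_ereal_sup => _ [n xn <-].
Qed.

(** As [u >= 0], the default [0] of the maximum never exceeds [u], even for empty [G]. *)
Lemma ltr_bigmax0 {R : realType} (I : finType) (G : {set I}) (F : I -> R) (u : R) : 0 <= u ->
  (u < \big[Num.max/0]_(j in G) F j) <-> exists2 j, j \in G & u < F j.
Proof.
move=> u0; split.
  move=> h; apply: contrapT => H; move: h; apply/negP; rewrite -leNgt.
  apply: bigmax_le => // j jG; rewrite leNgt; apply/negP => h; apply: H; by exists j.
move=> [j jG h]; apply: lt_le_trans h _.
exact: le_bigmax_cond.
Qed.

(* Index n : nat stands for sample size n.+1 (= 1, 2, ...). *)
Theorem theorem1 (R : realType) (d : measure_display) (T : measurableType d)
  (P : probability T R)
  (p : nat -> nat) (hp : forall n, (0 < p n)%N)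
  (X : forall n, 'M[R]_(n.+1, p n))
  (Ginv : forall n, 'M[R]_(n.+1))
  (hGinv : forall n, is_MP_pinv (X n *m (X n)^T) (Ginv n))
  (beta0 : forall n, 'cV[R]_(p n))
  (sigma : R) (hsigma : 0 < sigma)
  (eps : forall n, 'I_n.+1 -> T -> R)
  (heps_meas : forall n i, measurable_fun setT (eps n i))
  (heps_law : forall n i (B : set R), measurable B ->
      P (eps n i @^-1` B) = normal_prob 0 sigma B)
  (heps_indep : forall n, mutually_independent P (eps n))
  (lam : nat -> R) (hlam : forall n, 0 < lam n)
  (hOmin : forall n,
      0 < Omega_min (Omega_mx (Sigma_hat (X n)) (lam n)))
  (hrate : (fun n => Num.sqrt (n.+1%:R) * norm2 (PX (X n) (Ginv n) *m beta0 n)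
              * lam n
              * (Num.sqrt (Omega_min (Omega_mx (Sigma_hat (X n)) (lam n))))^-1
              * (lambda_min_nz (Sigma_hat (X n)))^-1) @ \oo --> (0 : R))
  (binit : forall n, T -> 'cV[R]_(p n))
  (hbinit_meas : forall n k, measurable_fun setT (fun w => binit n w k 0))
  (hbinit_est : forall n, exists f : 'cV[R]_(n.+1) -> 'cV[R]_(p n),
      forall w, binit n w = f (X n *m beta0 n + \col_i eps n i w))
  (Delta : forall n, 'I_(p n) -> R) (hDelta : forall n j, 0 < Delta n j)
  (hA : (fun n => P [set w | forall j : 'I_(p n),
           `| a_coef n.+1 sigma (Omega_mx (Sigma_hat (X n)) (lam n)) j *
              \sum_(k < p n | k != j)
                 PX (X n) (Ginv n) j k * (binit n w k 0 - beta0 n k 0) |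
           <= Delta n j]) @ \oo --> 1%E) :
  let Om n := Omega_mx (Sigma_hat (X n)) (lam n) in
  let a n j := a_coef n.+1 sigma (Om n) j in
  let bcorr n w j := ridge_corr (PX (X n) (Ginv n))
        (ridge (X n) (lam n) (X n *m beta0 n + \col_i eps n i w))
        (binit n w) j in
  (* (i) *)
  (forall jn : forall n, 'I_(p n), (forall n, beta0 n (jn n) 0 = 0) ->
   forall u : R, 0 < u ->
   (limn_esup (fun n =>
      P [set w | (u < a n (jn n) * `| bcorr n w (jn n) |)%R]
      - normal_prob 0 1 [set x : R | (u < `|x| + Delta n (jn n))%R]) <= 0)%E)
  /\
  (* (ii) *)
  (forall G : forall n, {set 'I_(p n)},
   (forall n j, j \in G n -> beta0 n j 0 = 0) ->
   forall u : R, 0 < u ->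
   forall (d' : measure_display) (T' : measurableType d')
          (Q : probability T' R) (Z : forall n, 'I_(p n) -> T' -> R),
   (forall n, gaussian_vector Q (Z n) ((n.+1%:R)^-1 * sigma ^+ 2 *: Om n)) ->
   (limn_esup (fun n =>
      P [set w | (u < \big[Num.max/0]_(j in G n) (a n j * `| bcorr n w j |))%R]
      - Q [set w' | (u < \big[Num.max/0]_(j in G n)
                            (a n j * `| Z n j w' | + Delta n j))%R]) <= 0)%E).
Proof.
move=> Om a bcorr.
pose B n := ridge_noise_mx (X n) (lam n).
pose Z n j w := \sum_i B n j i * eps n i w.
pose limit_event n (G : {set 'I_(p n)}) (u : R) :=
  [set w | exists2 j, j \in G & u < a n j * `|Z n j w| + Delta n j].
have a_gt0 n j : 0 < a n j by exact: a_coef_gt0.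
have a_ge0 n j : 0 <= a n j by exact: ltW.
have mZ n j : measurable_fun setT (Z n j).
  by apply: measurable_sum => i; exact: measurable_funM.
pose good n := [set w | forall j : 'I_(p n), `| a n j *
  \sum_(k < p n | k != j) PX (X n) (Ginv n) j k * (binit n w k 0 - beta0 n k 0) | <= Delta n j].
have good1 : (fun n => fine (P (good n))) @ \oo --> (1 : R).
  by apply: fine_cvg; exact: hA.
pose rate n := sigma^-1 * (Num.sqrt (n.+1%:R) * norm2 (PX (X n) (Ginv n) *m beta0 n)
              * lam n * (Num.sqrt (Omega_min (Om n)))^-1 * (lambda_min_nz (Sigma_hat (X n)))^-1).
have rate0 : rate @ \oo --> (0 : R).
  by rewrite -(mulr0 sigma^-1); apply: cvgM hrate; exact: cvg_cst.
(* The estimate common to both parts; the first uses it for singletons. *)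
have key (G : forall n, {set 'I_(p n)}) (u : R) : 0 < u ->
    (forall n j, j \in G n -> beta0 n j 0 = 0) ->
    forall r : R, 0 < r -> \forall n \near \oo,
    (P [set w | exists2 j, j \in G n & (u < a n j * `|bcorr n w j|)%R] <=
     P (limit_event n (G n) u) + r%:E)%E.
  move=> u0 nullG r r0.
  (* [m] is fixed first, making the anticoncentration error at most [r / 2]. For large [n] the level
     loss [|rate n|] is at most [1 / m], and the bad event takes the other half of [r]. *)
  have [m m0 mr] : exists2 m, (0 < m)%N & expR (u + 1) / m%:R <= r / 2.
    exists (Num.truncn (expR (u + 1) / (r / 2))).+1 => //.
    rewrite ler_pdivrMr// mulrC -ler_pdivrMr ?divr_gt0//.
    by rewrite ltW// truncnS_gt.
  have im0 : 0 < m%:R^-1 :> R by rewrite invr_gt0 ltr0n.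
  near=> n.
  have h1 : `|rate n| <= m%:R^-1.
    by near: n; move/cvgr0Pnorm_le : rate0; apply.
  have h2 : 1 - fine (P (good n)) <= r / 2.
    have : `|1 - fine (P (good n))| <= r / 2.
      by near: n; move/cvgrPdist_le : good1; apply; rewrite divr_gt0.
    by apply: le_trans; exact: ler_norm.
  have mdel : m%:R * `|rate n| <= 1.
    by rewrite mulrC -ler_pdivlMr ?ltr0n// mul1r.
  have := @corrected_ridge_tail R d T P n.+1 (p n) (X n) (Ginv n) (beta0 n) sigma (lam n)
    (eps n) isT (hGinv n) hsigma (hlam n) (heps_meas n) (heps_law n) (heps_indep n) (hOmin n)
    (binit n) (Delta n) (G n) (hbinit_meas n) (hDelta n) u `|rate n| m (nullG n) (ltW u0)
    (normr_ge0 _) m0 mdel.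
  have hb j : a n j * `|(lam n *: (invmx (Sigma_hat (X n) + (lam n)%:M) *m
      (PX (X n) (Ginv n) *m beta0 n))) j 0| <= `|rate n|.
    by apply: le_trans (ler_norm _); exact: a_coef_bias.
  move=> /(_ hb) h3; apply: le_trans h3 _.
  by rewrite leeD2l// lee_fin (splitr r); exact: lerD.
have fin_limit n (G : {set 'I_(p n)}) u : P (limit_event n G u) \is a fin_num.
  apply: fin_num_measure; rewrite /limit_event.
  rewrite (_ : mkset _ = \bigcup_(j in [set` G]) [set w | u < a n j * `|Z n j w| + Delta n j]).
    apply: fin_bigcup_measurable => // j _; apply: (measurable_ltr_set (f := cst u)) => //.
    by apply: measurable_funD => //; apply: measurable_funM => //; exact: measurableT_comp.
  by apply/seteqP; split => w [j jG h]; exists j.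
have gaussZ n : gaussian_vector P (Z n) (sigma ^+ 2 *: (B n *m (B n)^T)).
  exact: (gaussian_vector_linear_image (B n) hsigma (heps_meas n) (heps_law n) (heps_indep n)).
split.
- move=> jn null u u0; apply: limn_esup_le0 => r r0.
  have nullG n j : j \in [set jn n]%SET -> beta0 n j 0 = 0.
    by rewrite inE => /eqP ->.
  have := key (fun n => [set jn n]%SET) u u0 nullG r r0.
  apply: filterS => n; set A := (X in (P X <= _ -> _)%E).
  have -> : [set w | (u < a n (jn n) * `| bcorr n w (jn n) |)%R] = A.
    apply/seteqP; split => w /=; first by exists (jn n) => //; rewrite inE.
    by move=> [j]; rewrite inE => /eqP ->.
  have -> : normal_prob 0 1 [set x : R | (u < `|x| + Delta n (jn n))%R] =
      P (limit_event n [set jn n]%SET u).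
    (* Projecting [Z n] on this multiple of one coordinate gives a variable of variance one, hence a
       standard normal law. *)
    pose c j := if j == jn n then a n (jn n) else 0.
    have mtail : measurable [set x : R | (u < `|x| + Delta n (jn n))%R].
      apply: (measurable_ltr_set (f := cst u)) => //.
      by apply: measurable_funD => //; exact: measurableT_comp.
    have := (gaussZ n).2 c _ mtail.
    have -> : \sum_(i < p n) \sum_(k < p n) c i * (sigma ^+ 2 *: (B n *m (B n)^T)) i k * c k = 1.
      rewrite (bigD1 (jn n))//= [X in _ + X]big1 ?addr0; last first.
        by move=> i /negbTE ij; apply: big1 => k _; rewrite /c ij !mul0r.
      rewrite (bigD1 (jn n))//= [X in _ + X]big1 ?addr0; last first.
        by move=> i /negbTE ij; rewrite /c ij mulr0.
      rewrite /c eqxx -(a_coef_unit_variance (isT : (0 < n.+1)%N) hsigma (hOmin n) (jn n)).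
      rewrite mxE mulmx_trE -mulr_suml.
      under [in RHS]eq_bigr do rewrite exprMn.
      by rewrite -mulr_sumr -/(a _ _) -/(B _); ring.
    rewrite /gauss0 oner_eq0 sqrtr1 => <-.
    have cZ w : \sum_(i < p n) c i * Z n i w = a n (jn n) * Z n (jn n) w.
      rewrite (bigD1 (jn n))//= [X in _ + X]big1 ?addr0; last first.
        by move=> i /negbTE ij; rewrite /c ij mul0r.
      by rewrite /c eqxx.
    congr (P _); apply/seteqP; split => w; rewrite /limit_event/= cZ normrM gtr0_norm//.
      by move=> h; exists (jn n) => //; rewrite inE.
    by move=> [j]; rewrite inE => /eqP ->.
  by move=> h; rewrite leeBlDr// addeC.
- move=> G nullG u u0 d' T' Q Z' gZ'; apply: limn_esup_le0 => r r0.
  have := key G u u0 nullG r r0.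
  apply: filterS => n h.
  have -> : [set w | (u < \big[Num.max/0]_(j in G n) (a n j * `| bcorr n w j |))%R] =
      [set w | exists2 j, j \in G n & (u < a n j * `|bcorr n w j|)%R].
    by apply/seteqP; split => w /(ltr_bigmax0 _ _ (ltW u0)).
  have -> : Q [set w' | (u < \big[Num.max/0]_(j in G n)
      (a n j * `| Z' n j w' | + Delta n j))%R] = P (limit_event n (G n) u).
    rewrite (_ : [set w' | _] = [set w | exists2 j, j \in G n & (u < a n j * `|Z' n j w| + Delta n j)%R]); last first.
      by apply/seteqP; split => w /(ltr_bigmax0 _ _ (ltW u0)).
    apply/esym; apply: (gaussian_vector_box _ _ _ _ (gaussZ n)) => //.
    have OmE : Om n = n.+1%:R *: (B n *m (B n)^T) by exact: Omega_ridge_noise.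
    have -> : sigma ^+ 2 *: (B n *m (B n)^T) = (n.+1%:R^-1 * sigma ^+ 2) *: Om n.
      by rewrite OmE scalerA mulrAC mulVf ?mul1r// pnatr_eq0.
    exact: gZ'.
  by rewrite leeBlDr// addeC.
Unshelve. all: by end_near.
Qed.
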